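(* Let $d\in\mathbb{N}$ and let $\mathcal C$ be a class of finite graphs (finite $\sigma$-structures, $\sigma=\{E,P_1,\dots,P_N\}$) in which every vertex has degree at most $d$. Then for every order-invariant $\mathsf{CFO}$ sentence $\varphi$ there exists a first-order sentence $\psi$ over $\sigma$ such that for every $\mathcal A\in\mathcal C$: $\mathcal A\models\varphi$ if and only if $\mathcal A\models\psi$. In other words, order-invariant $\mathsf{CFO}$ is included in $\mathsf{FO}$ on $\mathcal C$.
   Context: Graphs are loopless undirected coloured simple graphs, viewed as structures over $\sigma=\{E,P_1,\dots,P_N\}$ with $E$ a binary relation interpreted as a symmetric loopless relation and the $P_\ell$ unary (colours). An ordered graph is a $\sigma\cup\{<\}$-structure where $<$ is a linear order on the vertices. Cluster first-order logic ($\mathsf{CFO}$): fix an infinite alphabet $\Sigma$. Variables are $x_w^i$ for $w\in\Sigma^*$, $i\in\mathbb N$ (variables with the same $w$ form the cluster $w$). For a finite $S\subseteq\Sigma^*\times\mathbb N$ let $X_S=\{x_w^i:(w,i)\in S\}$; $S$ is valid if $(w,i)\in S$ implies $(w,j)\in S$ for all $j<i$, and $(w\alpha,0)\in S$ (with $\alpha\in\Sigma$) implies $(w,0)\in S$. For valid $S$, $\mathsf{CFO}_S[0]$ is the closure under Boolean connectives of the atoms $P_\ell(x_w^i)$, $E(x_w^i,x_w^j)$, $x_w^i\sim x_w^j$, and $x_{w\alpha}^0\sim x_w^i$, for variables in $X_S$ and $\sim\in\{=,<,>\}$. $\mathsf{CFO}_S[k+1]$ is the closure under Boolean connectives of $\mathsf{CFO}_S[0]$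 together with: $\exists x_\epsilon^0\,\psi$ with $\psi\in\mathsf{CFO}_{\{(\epsilon,0)\}}[k]$ (only if $S=\emptyset$); $\exists x_{w\alpha}^0\,\psi$ where $(w,0)\in S$, $(w\alpha,0)\notin S$, $\alpha\in\Sigma$, $\psi\in\mathsf{CFO}_{S\cup\{(w\alpha,0)\}}[k]$; and $\exists x_w^i\,(E(x_w^i,x_w^j)\wedge\psi)$ where $(w,j)\in S$, $i$ is the least index with $(w,i)\notin S$, and $\psi\in\mathsf{CFO}_{S\cup\{(w,i)\}}[k]$. $\mathsf{CFO}=\bigcup_k\mathsf{CFO}_\emptyset[k]$; formulas have the usual first-order semantics over ordered graphs. A $\mathsf{CFO}$ sentence $\varphi$ is order-invariant if for every finite graph $\mathcal A$ and any two linear orders $<_1,<_2$ on its vertex set, $(\mathcal A,<_1)\models\varphi\iff(\mathcal A,<_2)\models\varphi$; in that case one writes $\mathcal A\models\varphi$. *)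

(* Defs.v *)
From mathcomp Require Import all_boot.
From mathcomp Require Import finmap.

Set Implicit Arguments.
Unset Strict Implicit.
Unset Printing Implicit Defensive.

Local Open Scope fset_scope.

(* First-order formulas over a relational signature whose unary symbols are
   the elements of U and whose binary symbols are those of B, with variables
   in X. *)
Inductive formula (U B X : Type) : Type :=
| Bot
| Eq of X & X
| Un of U & X
| Bin of B & X & X
| Not of formula U B X
| And of formula U B X & formula U B X
| Or of formula U B X & formula U B X
| Ex of X & formula U B X.

Arguments Bot {U B X}.
Arguments Eq {U B X}.
Arguments Un {U B X}.
Arguments Bin {U B X}.

Fixpoint free_vars (U B : Type) (X : eqType) (f : formula U B X) : seq X :=
  match f with
  | Bot => [::]
  | Eq x y => [:: x; y]
  | Un _ x => [:: x]
  | Bin _ x y => [:: x; y]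
  | Not g => free_vars g
  | And g h => free_vars g ++ free_vars h
  | Or g h => free_vars g ++ free_vars h
  | Ex x g => [seq y <- free_vars g | y != x]
  end.

Definition sentence (U B : Type) (X : eqType) (f : formula U B X) : Prop :=
  free_vars f = [::].

Section Semantics.
Variables (U B : Type) (X : eqType) (V : finType).
Variables (unI : U -> pred V) (binI : B -> rel V).

Definition upd (a : X -> option V) (x : X) (v : V) : X -> option V :=
  fun y => if y == x then Some v else a y.

(* Assignments are partial so that sentences also have a truth value in the
   empty structure. The values given to atoms with an unassigned variable are
   irrelevant for sentences. *)
Fixpoint sat (a : X -> option V) (f : formula U B X) : bool :=
  match f with
  | Bot => false
  | Eq x y => if (a x, a y) is (Some u, Some v) then u == v else false
  | Un p x => if a x is Some u then unI p u else false
  | Bin r x y => if (a x, a y) is (Some u, Some v) then binI r u v else false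
  | Not g => ~~ sat a g
  | And g h => sat a g && sat a h
  | Or g h => sat a g || sat a h
  | Ex x g => [exists v : V, sat (upd a x v) g]
  end.

Definition sat0 (f : formula U B X) : bool := sat (fun _ => None) f.

End Semantics.

Record cgraph (N : nat) := CGraph {
  vertex :> finType;
  edge : rel vertex;
  colour : 'I_N -> pred vertex;
  edge_sym : symmetric edge;
  edge_irr : irreflexive edge
}.

Definition degree (N : nat) (A : cgraph N) (v : A) : nat := #|edge v|.

(* Binary symbols of sigma and of sigma extended with the order; the unary
   symbols P_l are indexed by l : 'I_N. *)
Variant sigma_bin := SE.
Variant osigma_bin := OE | OLt.

Definition strict_linear_order (V : finType) (lt : rel V) : Prop :=
  [/\ irreflexive lt, transitive lt & forall x y, x != y -> lt x y || lt y x].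

Definition fo_models (N : nat) (X : eqType) (A : cgraph N)
    (f : formula 'I_N sigma_bin X) : bool :=
  sat0 (@colour N A) (fun b => let: SE := b in @edge N A) f.

Definition ord_models (N : nat) (X : eqType) (A : cgraph N) (lt : rel A)
    (f : formula 'I_N osigma_bin X) : bool :=
  sat0 (@colour N A)
    (fun b => match b with OE => @edge N A | OLt => lt end) f.

Definition order_invariant (N : nat) (X : eqType)
    (f : formula 'I_N osigma_bin X) : Prop :=
  forall (A : cgraph N) (lt1 lt2 : rel A),
    strict_linear_order lt1 -> strict_linear_order lt2 ->
    (ord_models lt1 f <-> ord_models lt2 f).

(* A |= f for an order-invariant f; by invariance, and since every finite set
   has a linear order, "some order" may equally be read as "every order". *)
Definition inv_models (N : nat) (X : eqType) (A : cgraph N)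
    (f : formula 'I_N osigma_bin X) : Prop :=
  exists2 lt : rel A, strict_linear_order lt & ord_models lt f.

Section CFO.
Variables (N : nat) (Sigma : choiceType).

(* The pair (w, i) is the variable x_w^i; the word w alpha is rcons w alpha. *)
Definition cvar : choiceType := (seq Sigma * nat)%type.
Definition cformula := formula 'I_N osigma_bin cvar.

Definition valid (S : {fset cvar}) : Prop :=
  (forall w i j, (w, i) \in S -> j < i -> (w, j) \in S) /\
  (forall w (alpha : Sigma), (rcons w alpha, 0) \in S -> (w, 0) \in S).

(* x > y stands for y < x. *)
Variant cmp_atom (x y : cvar) : cformula -> Prop :=
| CmpEq : cmp_atom x y (Eq x y)
| CmpLt : cmp_atom x y (Bin OLt x y)
| CmpGt : cmp_atom x y (Bin OLt y x).

Variant cfo_atom (S : {fset cvar}) : cformula -> Prop :=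
| CfoColour l w i : (w, i) \in S -> cfo_atom S (Un l (w, i))
| CfoEdge w i j : (w, i) \in S -> (w, j) \in S ->
    cfo_atom S (Bin OE (w, i) (w, j))
| CfoCmpIn w i j f : (w, i) \in S -> (w, j) \in S ->
    cmp_atom (w, i) (w, j) f -> cfo_atom S f
| CfoCmpUp w (alpha : Sigma) i f :
    (rcons w alpha, 0) \in S -> (w, i) \in S ->
    cmp_atom (rcons w alpha, 0) (w, i) f -> cfo_atom S f.

Inductive bool_closure (K : cformula -> Prop) : cformula -> Prop :=
| BcIn f : K f -> bool_closure K f
| BcBot : bool_closure K Bot
| BcNot f : bool_closure K f -> bool_closure K (Not f)
| BcAnd f g : bool_closure K f -> bool_closure K g -> bool_closure K (And f g)
| BcOr f g : bool_closure K f -> bool_closure K g -> bool_closure K (Or f g).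

Variant cfo_quant (K : {fset cvar} -> cformula -> Prop) (S : {fset cvar}) :
    cformula -> Prop :=
| CfoRoot f : S = fset0 -> K [fset (([::], 0) : cvar)] f ->
    cfo_quant K S (Ex ([::], 0) f)
| CfoChild w (alpha : Sigma) f :
    (w, 0) \in S -> (rcons w alpha, 0) \notin S ->
    K ((rcons w alpha, 0) |` S) f ->
    cfo_quant K S (Ex (rcons w alpha, 0) f)
| CfoNeighbour w i j f :
    (w, j) \in S ->
    (w, i) \notin S -> (forall i', i' < i -> (w, i') \in S) ->
    K ((w, i) |` S) f ->
    cfo_quant K S (Ex (w, i) (And (Bin OE (w, i) (w, j)) f)).

(* CFO_S[k]. Validity of S is not tested: it holds for S = fset0 and is
   preserved by the three quantifier rules (valid_root, valid_child and
   valid_neighbour below), so only valid S are reached from fset0. *)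
Fixpoint cfo (k : nat) (S : {fset cvar}) : cformula -> Prop :=
  match k with
  | 0 => bool_closure (cfo_atom S)
  | k'.+1 =>
      bool_closure
        (fun f => bool_closure (cfo_atom S) f \/ cfo_quant (cfo k') S f)
  end.

Definition cfo_sentence (f : cformula) : Prop := exists k, cfo k fset0 f.

Lemma valid0 : valid fset0.
Proof. by split=> [w i j|w alpha]; rewrite inE. Qed.

Lemma valid_root : valid [fset (([::], 0) : cvar)].
Proof.
split=> [w i j|w alpha]; rewrite !inE => /eqP[] //; first by move=> _ ->.
by case: w.
Qed.

Lemma valid_child S w (alpha : Sigma) :
  valid S -> (w, 0) \in S -> valid ((rcons w alpha, 0) |` S).
Proof.
case=> vi vw wS; split=> [u i j|u beta]; rewrite !inE => /orP[/eqP|].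
- by case=> -> ->.
- by move=> uS ji; rewrite (vi _ _ _ uS ji) orbT.
- by case=> /rcons_inj[-> _]; rewrite wS orbT.
- by move=> /vw->; rewrite orbT.
Qed.

Lemma valid_neighbour S w i j :
  valid S -> (w, j) \in S -> (forall i', i' < i -> (w, i') \in S) ->
  valid ((w, i) |` S).
Proof.
case=> vi vw wjS wiS; split=> [u k l|u beta]; rewrite !inE => /orP[/eqP|].
- by case=> -> -> /wiS->; rewrite orbT.
- by move=> uS lk; rewrite (vi _ _ _ uS lk) orbT.
- case=> uw _; rewrite (vw _ beta) ?orbT // uw.
  by case: j wjS => [|j] wjS //; apply: vi wjS _.
- by move=> /vw->; rewrite orbT.
Qed.

End CFO.

Definition infinite_alphabet (Sigma : eqType) : Prop :=
  forall s : seq Sigma, exists alpha, alpha \notin s.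

(* Main.v *)
Require Import Defs.
From mathcomp Require Import all_boot.
From mathcomp Require Import finmap.
From mathcomp Require Import zify.
From Stdlib Require Import Classical_Prop.

(** CFO compares the root of a cluster only with the elements of the parent
    cluster, so the truth of a CFO sentence of rank k is governed by a game on
    pairs of points: each point comes with the ordered ball of radius k around
    it, and the next pair has to sit in the same position relative to these
    balls only.

    Given two graphs A and B of degree at most d which agree on first-order
    sentences of large rank, one chooses orders on both for which Duplicator
    wins.  The vertices are spread over linearly ordered slots such that nearby
    vertices lie at least two slots apart and such that vertices near the ends
    of the order have their neighbours near the ends.  Ball types with few
    realisations go near the left end.  Every other ball type has so many
    realisations that, for each slot and each linear order of the ball, one can
    afford a vertex in that slot whose ball is ordered in this way.  Hence
    between any two vertices of a common ball one finds, away from the ends,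
    every ordered ball that occurs away from the ends; the order chosen on the
    rest of the graph is irrelevant.  Only boundedly many vertices are involved
    in this pattern, so a back-and-forth argument copies it from A to B. *)

Set Implicit Arguments.
Unset Strict Implicit.
Unset Printing Implicit Defensive.

(** * Balls and local isomorphisms *)

Lemma card_bigU (T I : finType) (P : pred I) (E : I -> {set T}) :
  #|\bigcup_(i | P i) E i| <= \sum_(i | P i) #|E i|.
Proof.
elim/big_rec2: _ => [|i S n _ IH]; first by rewrite cards0.
by apply: leq_trans (leq_card_setU _ _) _; rewrite leq_add2l.
Qed.

Section Balls.
Variables (N : nat) (G : cgraph N).

Fixpoint ball (i : nat) (v : G) : {set G} :=
  if i is i'.+1 then ball i' v :|: \bigcup_(u | edge v u) ball i' u
  else [set v].

Lemma ballS_subset i v : ball i v \subset ball i.+1 v.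
Proof. exact: subsetUl. Qed.

Lemma ball_le i j v x : i <= j -> x \in ball i v -> x \in ball j v.
Proof.
move=> /subnK<-; elim: (j - i) => [|m IH] // /IH.
by rewrite addSn; apply: subsetP (ballS_subset _ _) _.
Qed.

Lemma ball_refl i v : v \in ball i v.
Proof. by apply: (@ball_le 0) => //; rewrite inE. Qed.

Lemma ball_step i v u x : edge v u -> x \in ball i u -> x \in ball i.+1 v.
Proof. by move=> vu xu; rewrite inE; apply/orP; right; apply/bigcupP; exists u. Qed.

Lemma ballSP i v x :
  x \in ball i.+1 v -> x \in ball i v \/ exists2 u, edge v u & x \in ball i u.
Proof. by rewrite inE => /orP[|/bigcupP[u]]; [left | right; exists u]. Qed.

Lemma ball_trans i j x y z :
  y \in ball i x -> z \in ball j y -> z \in ball (i + j) x.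
Proof.
elim: i x => [|i IH] x; first by rewrite inE => /eqP->.
case/ballSP => [yx zy|[u xu yu] zy].
  by apply: (@ball_le (i + j)); [rewrite addSn | apply: IH].
by rewrite addSn; apply: ball_step xu _; apply: IH.
Qed.

Lemma ball_sym i x y : (y \in ball i x) = (x \in ball i y).
Proof.
have H: forall x y, y \in ball i x -> x \in ball i y; last by apply/idP/idP; apply: H.
elim: i => [|i IH] {}x {}y; first by rewrite !inE eq_sym.
case/ballSP => [/IH|[u xu /IH uy]]; first exact: ball_le.
rewrite -addn1; apply: ball_trans uy _.
by apply: (@ball_step 0 _ x); rewrite ?inE // edge_sym.
Qed.

Lemma card_ball d i v : (forall v : G, degree v <= d) -> #|ball i v| <= d.+1 ^ i.
Proof.
move=> deg; elim: i v => [|i IH] v; first by rewrite cards1.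
rewrite expnS mulSn; apply: leq_trans (leq_card_setU _ _) _.
apply: leq_add => //; apply: leq_trans (card_bigU _ _) _.
apply: (@leq_trans (\sum_(u | edge v u) d.+1 ^ i)); first exact: leq_sum.
by rewrite sum_nat_const leq_mul2r; apply/orP; right; apply: deg.
Qed.

Definition nbhd (i : nat) (X : {set G}) : {set G} := \bigcup_(x in X) ball i x.

Lemma nbhdP i (X : {set G}) y :
  reflect (exists2 x, x \in X & y \in ball i x) (y \in nbhd i X).
Proof. exact: bigcupP. Qed.

Lemma nbhd_trans i j (X : {set G}) x y :
  x \in nbhd i X -> y \in ball j x -> y \in nbhd (i + j) X.
Proof.
by case/nbhdP=> c cX xc yx; apply/nbhdP; exists c => //; apply: ball_trans xc yx.
Qed.

Lemma nbhd_le i j (X : {set G}) x : i <= j -> x \in nbhd i X -> x \in nbhd j X.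
Proof. by move=> ij /nbhdP[c cX xc]; apply/nbhdP; exists c => //; apply: ball_le xc. Qed.

Lemma card_nbhd d i (X : {set G}) :
  (forall v : G, degree v <= d) -> #|nbhd i X| <= #|X| * d.+1 ^ i.
Proof.
move=> deg; apply: leq_trans (card_bigU _ _) _.
by rewrite -sum_nat_const; apply: leq_sum => v _; apply: card_ball.
Qed.

End Balls.

Section Links.
Variables (N : nat) (A B : cgraph N).
Implicit Type F : A -> B -> bool.

(** An [i]-step bisimulation along edges that stays inside [F]. When [F] is a partial isomorphism,
    it says that [F] matches the two balls of radius [i], without naming a map or its inverse. *)
Fixpoint lk (i : nat) F (x : A) (x' : B) : bool :=
  F x x' && (if i is i'.+1 then
    [forall y, edge x y ==> [exists y', edge x' y' && lk i' F y y']] &&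
    [forall y', edge x' y' ==> [exists y, edge x y && lk i' F y y']]
  else true).

Lemma lk_rel i F x x' : lk i F x x' -> F x x'.
Proof. by case: i => [|i] /= /andP[]. Qed.

Lemma lk0 F x x' : lk 0 F x x' = F x x'.
Proof. exact: andbT. Qed.

Lemma lkS i F x x' : lk i.+1 F x x' =
  [&& F x x', [forall y, edge x y ==> [exists y', edge x' y' && lk i F y y']] &
    [forall y', edge x' y' ==> [exists y, edge x y && lk i F y y']]].
Proof. by []. Qed.

Lemma lkSP i F x x' :
  reflect [/\ F x x',
    forall y, edge x y -> exists2 y', edge x' y' & lk i F y y' &
    forall y', edge x' y' -> exists2 y, edge x y & lk i F y y']
  (lk i.+1 F x x').
Proof.
rewrite lkS.
apply: (iffP idP) => [/and3P[-> /forallP f /forallP b]|[-> f b]].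
  split=> // y xy; [have:= f y | have:= b y]; rewrite xy implyTb;
  by case/existsP=> z /andP[]; exists z.
by rewrite andTb; apply/andP; split; apply/forallP=> y; apply/implyP => /[dup] xy;
  [move/f | move/b] => -[z e l]; apply/existsP; exists z; rewrite e.
Qed.

Lemma lk_le i j F x x' : i <= j -> lk j F x x' -> lk i F x x'.
Proof.
elim: i j x x' => [|i IH] [|j] x x' // ij.
  by rewrite lk0; apply: lk_rel.
move/lkSP=> [fx f b]; apply/lkSP; split=> // y /[dup] xy; [move/f | move/b] => -[z e l];
  by exists z => //; apply: IH l.
Qed.

Lemma lk_mono i F F' x x' :
  (forall y y', F y y' -> F' y y') -> lk i F x x' -> lk i F' x x'.
Proof.
move=> FF'; elim: i x x' => [|i IH] x x'; first by rewrite !lk0; apply: FF'.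
move/lkSP=> [/FF' fx f b]; apply/lkSP; split=> // y; [move/f | move/b] => -[z e /IH l];
  by exists z.
Qed.

Lemma lk_ball i j F x x' y : lk (i + j) F x x' -> y \in ball i x ->
  exists2 y', y' \in ball i x' & lk j F y y'.
Proof.
elim: i x x' => [|i IH] x x'; first by rewrite inE => l /eqP->; exists x'; rewrite ?inE.
rewrite addSn => l /ballSP[yx|[u xu yu]].
  case: (IH x x' (lk_le (leqnSn _) l) yx) => y' y'x' ly.
  by exists y' => //; apply: ball_le y'x'.
case/lkSP: l => _ /(_ _ xu)[u' e lu] _.
by case: (IH _ _ lu yu) => y' y'u' ly; exists y' => //; apply: ball_step y'u'.
Qed.

(** At most [i] steps from a point at distance at most [p] stay within radius [p + i], and every
    point met has depth [j] left; so [F] may be cut down to such pairs. *)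
Lemma lk_restrict i j p k F a b x x' : p + i <= k ->
  x \in ball p a -> x' \in ball p b -> lk (i + j) F x x' ->
  lk i (fun y y' => [&& lk j F y y', y \in ball k a & y' \in ball k b]) x x'.
Proof.
elim: i p x x' => [|i IH] p x x' pk xa x'b l.
  rewrite addn0 in pk.
  by rewrite lk0; apply/and3P; split; rewrite ?(ball_le pk).
have pk' : p <= k by rewrite (leq_trans _ pk) ?leq_addr.
apply/lkSP; rewrite addSn in l; split.
- by apply/and3P; split; rewrite ?(ball_le pk') // (lk_le _ l) // -addSn leq_addl.
- case/lkSP: l => _ f _ y xy; case: (f y xy) => y' e ly; exists y' => //.
  apply: (IH p.+1) ly; rewrite ?addSnnS // -addn1.
    by apply: ball_trans xa _; apply: ball_step xy _; rewrite inE.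
  by apply: ball_trans x'b _; apply: ball_step e _; rewrite inE.
- case/lkSP: l => _ _ f y' xy; case: (f y' xy) => y e ly; exists y => //.
  apply: (IH p.+1) ly; rewrite ?addSnnS // -addn1.
    by apply: ball_trans xa _; apply: ball_step e _; rewrite inE.
  by apply: ball_trans x'b _; apply: ball_step xy _; rewrite inE.
Qed.

End Links.

Definition swap_rel (X Y : Type) (F : X -> Y -> bool) : Y -> X -> bool :=
  fun y x => F x y.

Lemma lk_swap N (A B : cgraph N) i (F : A -> B -> bool) x x' :
  lk i (swap_rel F) x' x = lk i F x x'.
Proof.
elim: i x x' => [|i IH] x x' //.
apply/lkSP/lkSP=> -[fx f b]; split=> // y xy;
  by [case: (b y xy) => z e l; exists z; rewrite // -?IH // IH |
      case: (f y xy) => z e l; exists z; rewrite // -?IH // IH].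
Qed.

Lemma lk_ball_back N (A B : cgraph N) i j (F : A -> B -> bool) x x' y' :
  lk (i + j) F x x' -> y' \in ball i x' -> exists2 y, y \in ball i x & lk j F y y'.
Proof.
rewrite -lk_swap => l /(lk_ball l)[y yx]; rewrite lk_swap => ly.
by exists y.
Qed.

(** * The game played on clusters *)

Section Game.
Variables (N : nat) (A B : cgraph N) (ltA : rel A) (ltB : rel B).
Implicit Type F : A -> B -> bool.

Definition piso F : Prop := forall x x' y y', F x x' -> F y y' ->
  [/\ (x == y) = (x' == y'), edge x y = edge x' y' &
      forall l, colour l x = colour l x'].

Definition order_preserving F : Prop :=
  forall x x' y y', F x x' -> F y y' -> ltA x y = ltB x' y'.

Definition same_cmp F (z : A) (z' : B) : Prop := forall x x', F x x' ->
  [/\ (z == x) = (z' == x'), ltA z x = ltB z' x' & ltA x z = ltB x' z'].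

(* Duplicator wins the game in which each point comes with the ball around it
   and the next pair of points must lie in the same position relative to that
   ball, but to nothing chosen before: CFO compares x_{w alpha}^0 with the
   cluster w only. *)
Fixpoint sim (n : nat) (a : A) (b : B) : Prop :=
  exists F, [/\ piso F, order_preserving F, lk n F a b &
    if n is n'.+1 then
      (forall z, exists2 z', same_cmp F z z' & sim n' z z') /\
      (forall z', exists2 z, same_cmp F z z' & sim n' z z')
    else True].

(** The response clause of [sim] without the current pair; for the empty relation it describes the
    position before the first move. *)
Definition moves (n : nat) F : Prop :=
  if n is n'.+1 then
    (forall z, exists2 z', same_cmp F z z' & sim n' z z') /\
    (forall z', exists2 z, same_cmp F z z' & sim n' z z')
  else True.

Lemma simP n a b : sim n a b <->
  exists F, [/\ piso F, order_preserving F, lk n F a b & moves n F].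
Proof. by case: n. Qed.

Lemma sim_pred n a b : sim n.+1 a b -> sim n a b.
Proof.
elim: n a b => [|n IH] a b /simP[F [iF oF lF [f g]]]; apply/simP; exists F;
  split=> //; try exact: lk_le lF.
by split=> z; [case: (f z) | case: (g z)] => z' c /IH; exists z'.
Qed.

Lemma moves_pred n F : moves n.+1 F -> moves n F.
Proof.
case: n => // n [f g].
by split=> z; [case: (f z) | case: (g z)] => z' c /sim_pred; exists z'.
Qed.

(** * Preservation of CFO formulas by the game *)

Section Sat.
Variable Sigma : choiceType.
Implicit Types (S : {fset cvar Sigma}) (al : cvar Sigma -> option A)
  (be : cvar Sigma -> option B).

Local Notation satA := (sat (@colour N A)
    (fun b => match b with OE => @edge N A | OLt => ltA end)).
Local Notation satB := (sat (@colour N B)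
    (fun b => match b with OE => @edge N B | OLt => ltB end)).

(** Each cluster [w] has its own relation [Fw w]; clusters are linked only through the position of
    the first point of a child relative to the relation of its parent, just as the atoms of CFO
    allow. *)
Definition cluster_inv k S al be (Fw : seq Sigma -> A -> B -> bool) : Prop :=
  [/\ forall w, (w, 0) \in S ->
        [/\ piso (Fw w), order_preserving (Fw w) & moves k (Fw w)],
      forall w i, (w, i) \in S -> exists x x',
        [/\ al (w, i) = Some x, be (w, i) = Some x' & lk k (Fw w) x x'] &
      forall w c, (rcons w c, 0) \in S -> exists z z',
        [/\ al (rcons w c, 0) = Some z, be (rcons w c, 0) = Some z'
          & same_cmp (Fw w) z z']].

Lemma valid_base S w i : valid S -> (w, i) \in S -> (w, 0) \in S.
Proof. by move=> [v _]; case: i => // i /v; apply. Qed.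

Lemma cluster_inv_pred k S al be Fw :
  cluster_inv k.+1 S al be Fw -> cluster_inv k S al be Fw.
Proof.
move=> [i1 i2 i3]; split=> // [w /i1[? ? /moves_pred]|w i /i2[x [x' [? ? l]]]] //.
by exists x, x'; split=> //; apply: lk_le l.
Qed.

Lemma sat_atom k S al be Fw f : valid S -> cluster_inv k S al be Fw ->
  cfo_atom S f -> satA al f = satB be f.
Proof.
move=> vS [i1 i2 i3]; case.
- move=> l w i /[dup]/(valid_base vS)/i1[pF _ _] /i2[x [x' [/= -> -> /lk_rel xx]]].
  by case: (pF _ _ _ _ xx xx).
- move=> w i j /[dup]/(valid_base vS)/i1[pF _ _] /i2[x [x' [/= -> -> /lk_rel xx]]].
  move=> /i2[y [y' [/= -> -> /lk_rel yy]]].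
  by case: (pF _ _ _ _ xx yy).
- move=> w i j {}f /[dup]/(valid_base vS)/i1[pF oF _] /i2[x [x' [ax bx /lk_rel xx]]].
  move=> /i2[y [y' [ay b_y /lk_rel yy]]].
  case=> /=; rewrite ax bx ay b_y; [|exact: oF|exact: oF].
  by case: (pF _ _ _ _ xx yy).
- move=> w c i {}f /i3[z [z' [az bz zz]]] /i2[x [x' [ax bx /lk_rel xx]]].
  by case=> /=; rewrite ax bx az bz; case: (zz _ _ xx).
Qed.

Lemma sat_bool_closure (K : cformula N Sigma -> Prop) al be f :
  (forall f, K f -> satA al f = satB be f) ->
  bool_closure K f -> satA al f = satB be f.
Proof. by move=> H; elim=> [g /H||? _ /= ->|? ? _ /= -> _ ->|? ? _ /= -> _ ->]. Qed.

(** Each quantifier uses up one round: the root rule the first move (hence the hypothesis at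
    [S = fset0]), the child rule a response for the parent's relation, which brings a new relation,
    and the neighbour rule one step of [lk]. *)
Lemma sat_cfo k S al be Fw f : valid S ->
  (S = fset0%fset -> moves k (fun _ _ => false)) -> cluster_inv k S al be Fw ->
  cfo k S f -> satA al f = satB be f.
Proof.
elim: k S al be Fw f => [|k IH] S al be Fw f vS root inv.
  by apply: sat_bool_closure => g; apply: sat_atom vS inv.
apply: sat_bool_closure => {}f [|].
  by apply: sat_bool_closure => g; apply: sat_atom vS inv.
have inv' := cluster_inv_pred inv.
have Eb (P : pred A) (Q : pred B) : (forall z, exists z', P z = Q z') ->
    (forall z', exists z, P z = Q z') -> [exists z, P z] = [exists z', Q z'].
  move=> PQ QP; apply/existsP/existsP=> -[z]; [case: (PQ z)|case: (QP z)] => z' E Pz;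
  by exists z'; move: Pz; rewrite E.
case.
- move=> {}f S0 Kf; rewrite /=.
  have step z z' : sim k z z' ->
      satA (upd al ([::], 0) z) f = satB (upd be ([::], 0) z') f.
    move/simP=> [F [pF oF lF mF]].
    apply: (IH _ _ _ (fun _ => F) _ (valid_root Sigma)) Kf.
      by move=> /fsetP/(_ ([::], 0)); rewrite !inE eqxx.
    split=> [w _|w i|w c]; first by split.
      by rewrite inE => /eqP->; exists z, z'; rewrite /upd eqxx.
    by rewrite inE => /eqP[]; case: (w).
  by case: (root S0) => m1 m2; apply: Eb => z; [case: (m1 z)|case: (m2 z)] => z' _ /step;
    exists z'.
- move=> w c {}f wS wcS Kf; rewrite /=.
  case: inv => i1 _ _; case: (i1 _ wS) => pw ow [m1 m2].
  have step z z' : same_cmp (Fw w) z z' -> sim k z z' ->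
      satA (upd al (rcons w c, 0) z) f = satB (upd be (rcons w c, 0) z') f.
    move=> zz /simP[F [pF oF lF mF]].
    case: inv' => j1 j2 j3.
    (* By validity no variable of the cluster [rcons w c] or of its children is in [S], so its
       relation may be overwritten. *)
    apply: (IH _ _ _ (fun u => if u == rcons w c then F else Fw u) _
      (valid_child c vS wS)) Kf.
      by move=> /fsetP/(_ (rcons w c, 0)); rewrite !inE eqxx.
    split=> [u|u i|u e]; rewrite !inE.
    + rewrite xpair_eqE andbT; case: eqP => [_ _|_ /j1 //]; by split.
    + case: eqP => [[-> ->] _|ne /=].
        by exists z, z'; rewrite /upd !eqxx.
      case: eqP => [-> uS|_ /j2[x [x' [ax bx xx]]]].
        by rewrite (valid_base vS uS) in wcS.
      by exists x, x'; rewrite /upd; move/eqP/negbTE: ne => ->.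
    + case: eqP => [[/rcons_inj[-> ->]] _|ne /= uS].
        exists z, z'; rewrite /upd eqxx; split=> //.
        by rewrite -[X in X == _]cats0 -cats1 eqseq_cat // andbF.
      case: (j3 _ _ uS) => x [x' [ax bx xx]].
      exists x, x'; rewrite /upd; move/eqP/negbTE: (ne) => ->.
      split=> //; case: eqP => // uw; case: vS => _ /(_ _ _ uS).
      by rewrite uw (negbTE wcS).
  by apply: Eb => z; [case: (m1 z)|case: (m2 z)] => z' zz /(step _ _ zz); exists z'.
- move=> w i j {}f wjS wiS wlt Kf; rewrite /=.
  have w0 := valid_base vS wjS.
  have i_gt0 : 0 < i by case: (i) wiS => //; rewrite w0.
  have nji : (w, j) == (w, i) = false.
    by apply/eqP => E; rewrite E (negbTE wiS) in wjS.
  have step x x' : lk k (Fw w) x x' ->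
      satA (upd al (w, i) x) f = satB (upd be (w, i) x') f.
    move=> xx; case: inv' => j1 j2 j3.
    apply: (IH _ _ _ Fw _ (valid_neighbour vS wjS wlt)) Kf.
      by move=> /fsetP/(_ (w, i)); rewrite !inE eqxx.
    split=> [u|u e|u e]; rewrite !inE.
    + by case/orP=> [/eqP[-> _]|/j1//]; apply: j1.
    + case: eqP => [[-> ->] _|ne /=].
        by exists x, x'; rewrite /upd !eqxx.
      move/j2=> [y [y' [ay b_y yy]]].
      by exists y, y'; rewrite /upd; move/eqP/negbTE: ne => ->.
    + case: eqP => [[_ E]|ne /= /j3]; first by rewrite -E in i_gt0.
      move=> [y [y' [ay b_y yy]]].
      by exists y, y'; rewrite /upd; move/eqP/negbTE: ne => ->.
  case: inv => i1 i2 _; case: (i1 _ w0) => pw ow _.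
  case: (i2 _ _ wjS) => y [y' [ay b_y /lkSP[_ f1 f2]]].
  have E : [exists z, edge z y && satA (upd al (w, i) z) f] =
           [exists z, edge z y' && satB (upd be (w, i) z) f].
    apply/existsP/existsP => -[z /andP[zy Sz]]; rewrite edge_sym in zy;
      [case: (f1 _ zy) | case: (f2 _ zy)] => z' zy' /step E;
      by exists z'; rewrite edge_sym zy' ?E // -E.
  transitivity [exists z, edge z y && satA (upd al (w, i) z) f].
    by apply: eq_existsb => z; rewrite {1 2}/upd eqxx nji ay.
  by rewrite E; apply: eq_existsb => z; rewrite {2 3}/upd eqxx nji b_y.
Qed.

Lemma moves_ord_models k (f : cformula N Sigma) : cfo k fset0%fset f ->
  moves k (fun _ _ => false) -> ord_models ltA f = ord_models ltB f.
Proof.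
move=> cf m; apply: (@sat_cfo k fset0%fset _ _ (fun _ _ _ => false)) cf => //.
Qed.

End Sat.
End Game.

(** * Slotted orders *)

(** A whole slot lies strictly between [m] and [n], so a new vertex can be put there and compared
    with both by slots alone. *)
Definition apart (m n : nat) : bool := (m.+1 < n) || (n.+1 < m).

Lemma apart_sym m n : apart m n = apart n m.
Proof. exact: orbC. Qed.

Section Layout.
(* Q slots, and a safety margin of E slots at both ends for every round. *)
Variables (N k Q E : nat).
Hypothesis Q_large : 2 * (k * E) <= Q.

Definition deep (n s : nat) : bool := (n * E < s) && (s + n * E < Q).

Lemma deep_le m n s : m <= n -> deep n s -> deep m s.
Proof.
rewrite /deep => mn /andP[a b]; have: m * E <= n * E by rewrite leq_mul2r mn orbT.
by lia.
Qed.

(** The last field accounts for one margin [E] per round: passing from a vertex to another vertex of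
    its ball loses at most one margin. *)
Record slotted (G : cgraph N) (s : G -> nat) (lt : rel G) : Prop := Slotted {
  slotted_order : strict_linear_order lt;
  slotted_lt : forall x y, s x < s y -> lt x y;
  slotted_apart : forall x y, x != y -> y \in ball (2 * k) x ->
    apart (s x) (s y);
  slotted_deep : forall n v y, n < k -> y \in ball (k * k) v ->
    n.+1 * E <= s v -> s v + n.+1 * E <= Q -> deep n (s y)
}.

Section TwoGraphs.
Variables (A B : cgraph N) (ltA : rel A) (ltB : rel B).
Variables (sA : A -> nat) (sB : B -> nat).

Definition ordered_copy (z : A) (u : B) : Prop :=
  exists F, [/\ piso F, order_preserving ltA ltB F, lk (k * k) F z u &
    forall x x', F x x' -> x \in ball (k * k) z /\ x' \in ball (k * k) u].

(** Lets the answer to [z] be placed in whichever slot the comparisons prescribe. *)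
Definition universal : Prop := forall z j, deep 1 (sA z) -> E <= j ->
  j + E <= Q -> exists2 u, sB u = j & ordered_copy z u.

Definition common_ends (Io : A -> B -> bool) : Prop :=
  [/\ piso Io, order_preserving ltA ltB Io,
      forall x x', Io x x' -> sA x = sB x' &
      forall x, ~~ deep k (sA x) -> exists x', lk (k * k) Io x x'].

Definition end_respecting Io n (F : A -> B -> bool) : Prop :=
  forall x x', F x x' -> Io x x' \/ deep n (sA x) /\ deep n (sB x').

(** Duplicator's invariant with [n] rounds left; the radius is [n * k] because each round may pass
    to a point at distance up to [k]. *)
Definition good Io n a b : Prop := exists F,
  [/\ piso F, order_preserving ltA ltB F, end_respecting Io n F &
      lk (n * k) F a b].

Hypothesis slA : slotted sA ltA.
Hypothesis slB : slotted sB ltB.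

Lemma lt_slot (G : cgraph N) (s : G -> nat) (lt : rel G) x y :
  slotted s lt -> s x < s y ->
  [/\ (x == y) = false, (y == x) = false, lt x y & lt y x = false].
Proof.
move=> sl xy; have lxy := slotted_lt sl xy; have [irr tr _] := slotted_order sl.
have ne : (x == y) = false by apply/eqP => e; rewrite e ltnn in xy.
split=> //; first by rewrite eq_sym.
by apply/negP => yx; have := tr _ _ _ lxy yx; rewrite irr.
Qed.

Lemma same_cmp_slot (F : A -> B -> bool) z z' :
  (forall x x', F x x' -> (sA z < sA x /\ sB z' < sB x') \/
     (sA x < sA z /\ sB x' < sB z')) -> same_cmp ltA ltB F z z'.
Proof.
move=> H x x' /H[] [/(lt_slot slA)[a1 a2 a3 a4] /(lt_slot slB)[b1 b2 b3 b4]].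
  by rewrite a1 a3 a4 b1 b3 b4.
by rewrite a2 a3 a4 b2 b3 b4.
Qed.

Section Respond.
Variable Io : A -> B -> bool.
Hypothesis ends : common_ends Io.
Hypothesis univ : universal.

(** Near an end, [z] is answered by its image under the common ends. Elsewhere the images of the
    points below and above [z] leave a slot free between them, and [univ] puts a copy of the ordered
    ball of [z] there. *)
Lemma respond n (F : A -> B -> bool) z : n < k -> piso F -> order_preserving ltA ltB F ->
  end_respecting Io n.+1 F ->
  (forall x x' y y', F x x' -> F y y' -> x != y -> apart (sB x') (sB y')) ->
  (forall x x', F x x' -> z != x) ->
  exists2 z', same_cmp ltA ltB F z z' & good Io n z z'.
Proof.
move=> nk pF oF eF aF zF; have [pI oI sI totI] := ends.
have [irrA trA totA] := slotted_order slA.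
case: (boolP (deep n.+1 (sA z))) => [dz|ndz]; last first.
  have [|z' l] := totI z; first by apply: contra ndz; apply: deep_le.
  have zz' := lk_rel l; exists z'; last first.
    exists Io; split=> //; first by left.
    by apply: lk_le l; rewrite leq_mul2r (ltnW nk) orbT.
  (* Pairs of [Io] are compared by [Io] itself; a deep pair lies between the two margins, while [z]
     and [z'] share a slot in one of them, so the slots decide. *)
  move=> x x' Fx; case: (eF _ _ Fx) => [Ix|[dx dx']].
    by split; [case: (pI _ _ _ _ zz' Ix) | apply: oI | apply: oI].
  have szz := sI _ _ zz'.
  apply: (@same_cmp_slot (fun y y' => (y == x) && (y' == x'))) =>
    [y y' /andP[/eqP-> /eqP->]|].
    by rewrite -szz; move: dx dx' ndz; rewrite /deep; lia.
  by rewrite !eqxx.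
have kE : n.+1 * E <= k * E by rewrite leq_mul2r nk orbT.
(* [p] is one past the highest image of a point below [z], or 0 if there is none; [j] raises it to
   the margin. As images lie apart, [j] is still below every image of a point above [z]. *)
pose p := \max_(x' | [exists x, F x x' && ltA x z]) (sB x').+1.
pose j := maxn p (n.+1 * E).
have pP : forall x x', F x x' -> ltA x z -> sB x' < j.
  move=> x x' Fx xz; apply: leq_trans (leq_maxl _ _).
  apply: (bigmax_sup x') => //; apply/existsP; exists x.
  by rewrite Fx.
have sB_lt x x' y y' : F x x' -> F y y' -> ltA x y -> (sB x').+1 < sB y'.
  move=> Fx Fy xy; have ne : x != y by apply: contraTneq xy => ->; rewrite irrA.
  have := aF _ _ _ _ Fx Fy ne; rewrite /apart => /orP[//|/ltnW yx].
  by have [_ _ _] := lt_slot slB yx; rewrite -(oF _ _ _ _ Fx Fy) xy.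
have slot_ge x y : ltA x y -> sA x <= sA y.
  move=> xy; rewrite leqNgt; apply/negP => yx.
  by have [_ _ _] := lt_slot slA yx; rewrite xy.
have jq : forall y y', F y y' -> ltA z y -> j < sB y'.
  move=> y y' Fy zy; rewrite gtn_max; apply/andP; split.
    have sy : 0 < sB y'.
      case: (eF _ _ Fy) => [/sI<-|[_ /andP[H _]]]; last by apply: leq_trans H.
      by have := slot_ge _ _ zy; move: dz; rewrite /deep; lia.
    have {1}-> : sB y' = (sB y').-1.+1 by rewrite prednK.
    rewrite ltnS; apply/bigmax_leqP => x' /existsP[x /andP[Fx xz]].
    by have := sB_lt _ _ _ _ Fx Fy (trA _ _ _ xz zy); lia.
  case: (eF _ _ Fy) => [/sI<-|[_ /andP[]//]].
  by have := slot_ge _ _ zy; move: dz; rewrite /deep; lia.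
have jE : n.+1 * E <= j by apply: leq_maxr.
have jQ : j + n.+1 * E <= Q.
  rewrite /j; case: (leqP p (n.+1 * E)) => H; first by lia.
  have p0 : 0 < p by lia.
  have : p <= Q - n.+1 * E; last by lia.
  apply/bigmax_leqP => x' /existsP[x /andP[Fx xz]].
  case: (eF _ _ Fx) => [/sI<-|[_ /andP[]]]; last by lia.
  by have := slot_ge _ _ xz; move: dz; rewrite /deep; lia.
have E1 : E <= n.+1 * E by rewrite leq_pmull.
have [|||u su [F' [pF' oF' lF' bF']]] := univ (z := z) (j := j).
- by apply: deep_le dz.
- exact: leq_trans E1 jE.
- by apply: leq_trans jQ; rewrite leq_add2l.
exists u.
  have [irrB trB totB] := slotted_order slB.
  move=> x x' Fx; have zx := zF _ _ Fx.
  case/orP: (totA _ _ zx) => [/[dup] zx1|/[dup] xz1].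
    move/(jq _ _ Fx); rewrite -su => /(lt_slot slB)[-> _ -> ->].
    rewrite (negbTE zx) zx1; split=> //; apply/negP => xz1.
    by have := trA _ _ _ zx1 xz1; rewrite irrA.
  move/(pP _ _ Fx); rewrite -su => /(lt_slot slB)[_ -> -> ->].
  rewrite (negbTE zx) xz1; split=> //; apply/negP => zx1.
  by have := trA _ _ _ zx1 xz1; rewrite irrA.
exists F'; split=> //; last first.
  by apply: lk_le lF'; rewrite leq_mul2r (ltnW nk) orbT.
move=> x x' /bF'[xz xu]; right; split.
  by apply: (slotted_deep slA nk xz); move: dz => /andP[]; lia.
by apply: (slotted_deep slB nk xu); rewrite su.
Qed.

End Respond.
End TwoGraphs.

Lemma piso_swap (A B : cgraph N) (F : A -> B -> bool) : piso F -> piso (swap_rel F).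
Proof. by move=> pF x x' y y' Fx Fy; case: (pF _ _ _ _ Fx Fy) => ? ? c; split. Qed.

Lemma order_preserving_swap (A B : cgraph N) (ltA : rel A) (ltB : rel B)
    (F : A -> B -> bool) :
  order_preserving ltA ltB F -> order_preserving ltB ltA (swap_rel F).
Proof. by move=> oF x x' y y' Fx Fy; rewrite (oF _ _ _ _ Fx Fy). Qed.

Lemma same_cmp_swap (A B : cgraph N) (ltA : rel A) (ltB : rel B)
    (F : A -> B -> bool) z z' :
  same_cmp ltB ltA (swap_rel F) z' z -> same_cmp ltA ltB F z z'.
Proof. by move=> c x x' Fx; case: (c _ _ Fx). Qed.

Lemma good_swap (A B : cgraph N) (ltA : rel A) (ltB : rel B)
    (sA : A -> nat) (sB : B -> nat) (Io : A -> B -> bool) n a b :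
  good ltB ltA sB sA (swap_rel Io) n b a -> good ltA ltB sA sB Io n a b.
Proof.
case=> F [pF oF eF lF]; exists (swap_rel F); split.
- exact: piso_swap.
- exact: order_preserving_swap.
- by move=> x x' /eF[|[]]; [left | right].
- by rewrite lk_swap.
Qed.

Section Win.
Variables (A B : cgraph N) (ltA : rel A) (ltB : rel B).
Variables (sA : A -> nat) (sB : B -> nat) (Io : A -> B -> bool).
Hypothesis slA : slotted sA ltA.
Hypothesis slB : slotted sB ltB.
Hypothesis endsAB : common_ends ltA ltB sA sB Io.
Hypothesis endsBA : common_ends ltB ltA sB sA (swap_rel Io).
Hypothesis univAB : universal ltA ltB sA sB.
Hypothesis univBA : universal ltB ltA sB sA.

(** A point of the domain or range is answered by its partner, any other one by [respond], applied
    to the swapped graphs for the second half. *)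
Lemma good_moves n (F : A -> B -> bool) : n < k -> piso F -> order_preserving ltA ltB F ->
  end_respecting sA sB Io n.+1 F ->
  (forall x x' y y', F x x' -> F y y' -> x != y ->
     apart (sA x) (sA y) /\ apart (sB x') (sB y')) ->
  (forall z z', F z z' -> good ltA ltB sA sB Io n z z') ->
  (forall z z', good ltA ltB sA sB Io n z z' -> sim ltA ltB n z z') ->
  moves ltA ltB n.+1 F.
Proof.
move=> nk pF oF eF aF gF gs.
have self z z' : F z z' -> same_cmp ltA ltB F z z'.
  by move=> Fz x x' Fx; split; [case: (pF _ _ _ _ Fz Fx) | apply: oF | apply: oF].
split=> z.
  case: (pickP (F z)) => [z' Fz|noF]; first by exists z'; [apply: self | apply/gs/gF].
  have [|x x' Fx|z' c g] := respond slA slB endsAB univAB nk pF oF eF (z := z).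
  - by move=> x x' y y' Fx Fy ne; case: (aF _ _ _ _ Fx Fy ne).
  - by apply/eqP => e; rewrite -e noF in Fx.
  - by exists z' => //; apply: gs.
case: (pickP (swap_rel F z)) => [z' Fz|noF].
  by exists z'; [apply: self | apply/gs/gF].
have [||x x' Fx|z' c g] := respond slB slA endsBA univBA nk
    (piso_swap pF) (order_preserving_swap oF) (z := z).
- by move=> x x' /eF[|[]]; [left | right].
- move=> x x' y y' Fx Fy ne; have [Exy _ _] := pF _ _ _ _ Fx Fy.
  by rewrite -Exy in ne; case: (aF _ _ _ _ Fx Fy ne).
- by apply/eqP => e; rewrite -e noF in Fx.
- by exists z'; [apply: same_cmp_swap | apply/gs/good_swap].
Qed.

Lemma good_sim n a b : n <= k -> good ltA ltB sA sB Io n a b -> sim ltA ltB n a b.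
Proof.
elim: n a b => [|n IH] a b nk [F [pF oF eF lF]].
  by exists F; split.
(* Cutting to radius [k] puts any two points of the domain within distance [2 * k], hence in slots
   that are apart; keeping depth [n * k] makes every pair good for the next round. *)
pose F' x x' := [&& lk (n * k) F x x', x \in ball k a & x' \in ball k b].
have F'F x x' : F' x x' -> F x x' by case/and3P => /lk_rel.
have pF' : piso F' by move=> x x' y y' /F'F Fx /F'F; apply: pF.
have oF' : order_preserving ltA ltB F' by move=> x x' y y' /F'F Fx /F'F; apply: oF.
apply/simP; exists F'; split=> //.
  apply: (@lk_restrict _ _ _ _ _ 0); rewrite ?ball_refl //.
  by apply: lk_le lF; rewrite mulSn leq_add2r.
apply: good_moves => //.
- by move=> x x' /F'F/eF.
- move=> x x' y y' /[dup]/F'F Fx /and3P[_ xa xb] /[dup]/F'F Fy /and3P[_ ya yb] ne.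
  split.
    apply: (slotted_apart slA) => //; rewrite mul2n -addnn.
    by apply: ball_trans ya; rewrite ball_sym.
  apply: (slotted_apart slB); last first.
    by rewrite mul2n -addnn; apply: ball_trans yb; rewrite ball_sym.
  by case: (pF _ _ _ _ Fx Fy) => <-.
- move=> z z' /and3P[l _ _]; exists F; split=> // x x' /eF[|[dx dx']]; first by left.
  by right; split; [apply: deep_le dx | apply: deep_le dx'].
- by move=> z z'; apply: IH; apply: ltnW.
Qed.

Lemma layout_moves : moves ltA ltB k (fun _ _ => false).
Proof.
case: (posnP k) => [->//|/prednK nk]; rewrite -nk.
by apply: good_moves; rewrite ?nk // => z z'; apply: good_sim; rewrite leq_pred.
Qed.

End Win.
End Layout.

(** * Back-and-forth systems and Hintikka types *)

Section Zip.
Variables (X Y : eqType).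

Definition zip_rel (s : seq X) (t : seq Y) (x : X) (y : Y) : bool :=
  (x, y) \in zip s t.

Lemma zip_relP s t x y :
  reflect (exists2 i, onth s i = Some x & onth t i = Some y) (zip_rel s t x y).
Proof.
rewrite /zip_rel; apply: (iffP idP).
  elim: s t => [|a s IH] [|b t] //=; rewrite inE => /orP[/eqP[-> ->]|/IH[i]].
    by exists 0.
  by exists i.+1.
case=> i; elim: i s t => [|i IH] [|a s] [|b t] //=.
  by move=> [->] [->]; rewrite inE eqxx.
by rewrite inE => sx ty; rewrite (IH _ _ sx ty) orbT.
Qed.

Lemma zip_rel_mem s t x y : zip_rel s t x y -> x \in s /\ y \in t.
Proof.
rewrite /zip_rel; elim: s t => [|a s IH] [|b t] //=.
rewrite !inE => /orP[/eqP[-> ->]|/IH[-> ->]]; by rewrite ?eqxx ?orbT.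
Qed.

Lemma zip_rel_cat s1 s2 t1 t2 x y : size s1 = size t1 ->
  zip_rel (s1 ++ s2) (t1 ++ t2) x y = zip_rel s1 t1 x y || zip_rel s2 t2 x y.
Proof. by move=> E; rewrite /zip_rel zip_cat // mem_cat. Qed.

Lemma zip_rel_total s t x : size s = size t -> x \in s ->
  exists y, zip_rel s t x y.
Proof.
rewrite /zip_rel; elim: s t => [|a s IH] [|b t] //= [E]; rewrite inE => /orP[/eqP->|].
  by exists b; rewrite inE eqxx.
by move/(IH _ E) => [y xy]; exists y; rewrite inE xy orbT.
Qed.

End Zip.

Lemma zip_rel_swap (X Y : eqType) (s : seq X) (t : seq Y) x y :
  zip_rel t s y x = zip_rel s t x y.
Proof. by apply/zip_relP/zip_relP=> -[i]; exists i. Qed.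

Section BackAndForth.
Variables (N : nat) (A B : cgraph N).

Fixpoint bf (m : nat) (s : seq A) (t : seq B) : Prop :=
  [/\ size s = size t, piso (zip_rel s t) &
    if m is m'.+1 then
      (forall a, exists b, bf m' (rcons s a) (rcons t b)) /\
      (forall b, exists a, bf m' (rcons s a) (rcons t b))
    else True].

Lemma bf_size m s t : bf m s t -> size s = size t.
Proof. by case: m => [|m] []. Qed.

Lemma bf_piso m s t : bf m s t -> piso (zip_rel s t).
Proof. by case: m => [|m] []. Qed.

Lemma bf_pred m s t : bf m.+1 s t -> bf m s t.
Proof.
elim: m s t => [|m IH] s t [E p [f g]]; split=> //.
by split=> z; [case: (f z) | case: (g z)] => z' /IH; exists z'.
Qed.

Lemma bf_le m n s t : m <= n -> bf n s t -> bf m s t.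
Proof. by move=> /subnK<-; elim: (n - m) => [|j IH] // /bf_pred/IH. Qed.

Lemma bf_forth m s t l : bf (size l + m) s t ->
  exists2 l', size l' = size l & bf m (s ++ l) (t ++ l').
Proof.
elim: l s t => [|a l IH] s t; first by exists [::] => //; rewrite !cats0.
rewrite addSn => -[_ _ [/(_ a)[b /IH[l' E]]]]; rewrite !cat_rcons => bl _.
by exists (b :: l'); rewrite //= E.
Qed.

Lemma bf_back m s t l' : bf (size l' + m) s t ->
  exists2 l, size l = size l' & bf m (s ++ l) (t ++ l').
Proof.
elim: l' s t => [|a l IH] s t; first by exists [::] => //; rewrite !cats0.
rewrite addSn => -[_ _ [_ /(_ a)[b /IH[l' E]]]]; rewrite !cat_rcons => bl.
by exists (b :: l'); rewrite //= E.
Qed.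

Lemma zip_rel_rcons (s : seq A) (t : seq B) a b : size s = size t ->
  zip_rel (rcons s a) (rcons t b) a b.
Proof. by move=> E; rewrite -!cats1 zip_rel_cat // /zip_rel /= inE eqxx orbT. Qed.

Lemma zip_rel_rconsW (s : seq A) (t : seq B) a b x y :
  size s = size t -> zip_rel s t x y ->
  zip_rel (rcons s a) (rcons t b) x y.
Proof. by move=> E; rewrite -!cats1 zip_rel_cat // => ->. Qed.

(* One further round shows that the partner of a vertex whose neighbours all
   lie in the domain has no neighbours outside the range. *)
Lemma bf_lk i m s t x x' : bf m.+1 s t -> zip_rel s t x x' ->
  {subset ball i x <= s} -> lk i (zip_rel s t) x x'.
Proof.
move=> bst; have [E p [f g]] := bst.
elim: i x x' => [|i IH] x x' xx xs; first by rewrite lk0.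
have sub y : edge x y -> {subset ball i y <= s}.
  by move=> xy z zy; apply: xs; apply: ball_step xy zy.
apply/lkSP; split=> // y xy.
  have [y' yy] := zip_rel_total E (sub _ xy _ (ball_refl i y)).
  by exists y'; [case: (p _ _ _ _ xx yy) => _ <- _ | apply: IH (sub _ xy)].
have [z bz] := g y; have pz := bf_piso bz.
have xx1 := zip_rel_rconsW z y E xx.
have xz : edge x z by case: (pz _ _ _ _ xx1 (zip_rel_rcons z y E)) => _ -> _.
have [z' zz] := zip_rel_total E (sub _ xz _ (ball_refl i z)).
have [/esym] := pz _ _ _ _ (zip_rel_rconsW z y E zz) (zip_rel_rcons z y E).
rewrite eqxx => /eqP z'y _ _; rewrite z'y in zz.
by exists z => //; apply: IH (sub _ xz).
Qed.

End BackAndForth.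

Lemma piso_zip_swap N (A B : cgraph N) (s : seq A) (t : seq B) :
  piso (zip_rel s t) -> piso (zip_rel t s).
Proof.
move=> p x x' y y'; rewrite -!(zip_rel_swap t s) => xx yy.
exact: piso_swap p _ _ _ _ xx yy.
Qed.

Lemma bf_swap N (A B : cgraph N) m (s : seq A) (t : seq B) : bf m s t -> bf m t s.
Proof.
elim: m s t => [|m IH] s t [E p fg]; split=> //.
- exact: piso_zip_swap.
- exact: piso_zip_swap.
- case: fg => f g.
  by split=> z; [case: (g z) | case: (f z)] => z' /IH; exists z'.
Qed.

Section Hintikka.
Variable N : nat.
Local Notation fo := (formula 'I_N sigma_bin nat).

(** [None] marks a position without a value, so that the atomic type of a short enough list also
    fixes its length. *)
Definition bits_type : finType := option (bool * bool * {ffun 'I_N -> bool})%type.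
Definition atype (l : nat) : finType := {ffun 'I_l * 'I_l -> bits_type}.

(** Hintikka types of rank [m] for [l]-tuples, as a [finType], so that a conjunction can run over
    all of them. *)
Fixpoint htype (m l : nat) : finType :=
  if m is m'.+1 then (atype l * {set htype m' l.+1})%type else atype l.

Section OneGraph.
Variable G : cgraph N.
Implicit Type a : nat -> option G.

Definition bits (o1 o2 : option G) : bits_type :=
  if (o1, o2) is (Some x, Some y) then
    Some (x == y, edge x y, [ffun c => colour c x])
  else None.

Definition atp (l : nat) a : atype l := 
  [ffun p : 'I_l * 'I_l => bits (a p.1) (a p.2)].

Fixpoint htp (m l : nat) a : htype m l :=
  if m is m'.+1 return htype m l
  then (atp l a, [set htp m' l.+1 (upd a l v) | v : G]) else atp l a.

Lemma atp_ext l a a' : (forall i, i < l -> a i = a' i) -> atp l a = atp l a'.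
Proof. by move=> E; apply/ffunP => -[i j]; rewrite !ffunE /= !E. Qed.

Lemma htp_ext m l a a' : (forall i, i < l -> a i = a' i) -> htp m l a = htp m l a'.
Proof.
elim: m l a a' => [|m IH] l a a' E; first exact: atp_ext.
congr pair; first exact: atp_ext.
apply: eq_imset => v; apply: IH => i; rewrite ltnS leq_eqVlt /upd.
by case: eqP => //= _; apply: E.
Qed.

End OneGraph.

Lemma atp_size (A B : cgraph N) l (s : seq A) (t : seq B) :
  size s <= l -> size t <= l -> atp l (onth s) = atp l (onth t) -> size s = size t.
Proof.
have H : forall (A B : cgraph N) (s : seq A) (t : seq B),
    size s <= l -> atp l (onth s) = atp l (onth t) -> size s <= size t.
  move=> {A B s t} A B s t sl E; rewrite leqNgt; apply/negP => ts.
  have il := leq_trans ts sl.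
  move/ffunP: E => /(_ (Ordinal il, Ordinal il)); rewrite !ffunE /bits /=.
  have: onth s (size t) by rewrite onthTE.
  by case: (onth s _) => // x _; rewrite onth_default.
by move=> sl tl E; apply/eqP; rewrite eqn_leq (H _ _ _ _ sl E) (H _ _ _ _ tl (esym E)).
Qed.

Lemma atp_piso (A B : cgraph N) l (s : seq A) (t : seq B) :
  size s <= l -> atp l (onth s) = atp l (onth t) -> piso (zip_rel s t).
Proof.
move=> sl /ffunP E x x' y y' /zip_relP[i si ti] /zip_relP[j sj tj].
have lt n z : onth s n = Some z -> n < l.
  move=> sz; apply: leq_trans sl; rewrite ltnNge; apply/negP => /onth_default.
  by rewrite sz.
have := E (Ordinal (lt _ _ si), Ordinal (lt _ _ sj)).
rewrite !ffunE /bits /= si sj ti tj => -[-> -> /ffunP c]; split=> // e.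
by have := c e; rewrite !ffunE.
Qed.

Lemma piso_atp (A B : cgraph N) l (s : seq A) (t : seq B) :
  size s = size t -> piso (zip_rel s t) -> atp l (onth s) = atp l (onth t).
Proof.
move=> E p; apply/ffunP => -[i j]; rewrite !ffunE /bits /=.
have H n : (exists x y, onth s n = Some x /\ onth t n = Some y) \/
           onth s n = None /\ onth t n = None.
  case sn: (onth s n) => [x|]; case tn: (onth t n) => [y|].
  - by left; exists x, y.
  - by have := onthTE t n; rewrite -E -onthTE sn tn.
  - by have := onthTE t n; rewrite -E -onthTE sn tn.
  - by right.
case: (H i) => [[x [x' [sx tx]]]|[-> ->]] //; rewrite sx tx.
case: (H j) => [[y [y' [sy ty]]]|[-> ->]] //; rewrite sy ty.
have [||-> -> c] := p x x' y y'.
- by apply/zip_relP; exists i.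
- by apply/zip_relP; exists j.
by congr (Some (_, _)); apply/ffunP => e; rewrite !ffunE.
Qed.

Lemma htp_bf (A B : cgraph N) m (s : seq A) (t : seq B) : size s = size t ->
  htp m (size s) (onth s) = htp m (size s) (onth t) -> bf m s t.
Proof.
elim: m s t => [|m IH] s t E; first by split=> //; apply: atp_piso H.
case=> /atp_piso p /setP H; split=> //; first exact: p.
have ext (G : cgraph N) (r : seq G) v :
    htp m (size r).+1 (upd (onth r) (size r) v) = htp m (size r).+1 (onth (rcons r v)).
  apply: htp_ext => i; rewrite ltnS leq_eqVlt /upd -cats1 onth_cat.
  by case: eqP => [->|_ /= ->] //; rewrite ltnn subnn.
split=> z.
  have := H (htp m (size s).+1 (upd (onth s) (size s) z)).
  rewrite imset_f // => /esym/imsetP[z' _ e]; exists z'.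
  by apply: IH; rewrite !size_rcons ?E // -E -ext e E ext.
have := H (htp m (size s).+1 (upd (onth t) (size s) z)).
rewrite [X in _ = X]imset_f // => /imsetP[z' _ e]; exists z'.
by apply: IH; rewrite !size_rcons ?E // -E -ext -e E ext.
Qed.

Definition conjunction (I : finType) (F : I -> fo) : fo :=
  foldr (fun i g => And (F i) g) (Not Bot) (enum I).
Definition disjunction (fs : seq fo) : fo := foldr (fun f g => Or f g) Bot fs.
Definition literal (b : bool) (f : fo) : fo := if b then f else Not f.

Definition bits_form (i j : nat) (b : bits_type) : fo :=
  if b is Some (e, r, c) then
    And (literal e (Eq i j)) (And (literal r (Bin SE i j))
      (conjunction (fun l => literal (c l) (Un l i))))
  else Bot.

Definition atype_form (l : nat) (h : atype l) : fo :=
  conjunction (fun p : 'I_l * 'I_l => bits_form p.1 p.2 (h p)).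

Fixpoint htype_form (m l : nat) : htype m l -> fo :=
  if m is m'.+1 return htype m l -> fo then
    fun h => And (atype_form h.1)
      (conjunction (fun g => literal (g \in h.2) (Ex l (htype_form g))))
  else fun h => atype_form h.

Lemma free_conjunction (I : finType) (F : I -> fo) (P : pred nat) :
  (forall i, all P (free_vars (F i))) -> all P (free_vars (conjunction F)).
Proof.
by move=> H; rewrite /conjunction; elim: (enum I) => //= i r; rewrite all_cat H.
Qed.

Lemma free_literal b f : free_vars (literal b f) = free_vars f.
Proof. by case: b. Qed.

Lemma free_atype l (h : atype l) : all (gtn l) (free_vars (atype_form h)).
Proof.
apply: free_conjunction => -[i j] /=.
case: (h _) => //= -[[e r] c] /=; rewrite !all_cat !free_literal /= !ltn_ord /=.
by apply: free_conjunction => q; rewrite free_literal /= ltn_ord.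
Qed.

Lemma free_htype m l (h : htype m l) : all (gtn l) (free_vars (htype_form h)).
Proof.
elim: m l h => [|m IH] l h; first exact: free_atype.
rewrite /= all_cat free_atype /=; apply: free_conjunction => g.
rewrite free_literal /=; apply/allP => x; rewrite mem_filter => /andP[xl xg].
by have /= := allP (IH _ g) _ xg; rewrite ltnS leq_eqVlt (negbTE xl).
Qed.

Lemma sentence_htype m (h : htype m 0) : sentence (htype_form h).
Proof.
by rewrite /sentence; case: (free_vars _) (free_htype h).
Qed.

Section Sat.
Variable G : cgraph N.
Implicit Type a : nat -> option G.

Local Notation satG := (sat (@colour N G) (fun b => let: SE := b in @edge N G)).

Lemma sat_conjunction (I : finType) (F : I -> fo) a :
  satG a (conjunction F) = [forall i, satG a (F i)].
Proof.
transitivity (all (fun i => satG a (F i)) (enum I)).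
  by rewrite /conjunction; elim: (enum I) => //= i r ->.
by apply/allP/forallP => H i; [apply: H; rewrite mem_enum | move=> _; apply: H].
Qed.

Lemma sat_disjunction a fs : satG a (disjunction fs) = has (satG a) fs.
Proof. by elim: fs => //= f fs ->. Qed.

Lemma sat_literal a b f : satG a (literal b f) = (satG a f == b).
Proof. by case: b => /=; case: (satG a f). Qed.

Lemma sat_bits a i j b : a i -> a j -> satG a (bits_form i j b) = (bits (a i) (a j) == b).
Proof.
case ai: (a i) => [x|] // _; case aj: (a j) => [y|] // _.
case: b => [[[e r] c]|] //=; rewrite sat_conjunction !sat_literal /= ai aj.
rewrite /bits (inj_eq (@Some_inj _)) !xpair_eqE -andbA; congr [&& _, _ & _].
apply/forallP/eqP => [H|<- q].
  apply/ffunP => q; rewrite ffunE.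
  by have := H q; rewrite sat_literal /= ai => /eqP.
by rewrite sat_literal /= ai ffunE.
Qed.

Lemma sat_atype a l (h : atype l) : (forall i, i < l -> a i) ->
  satG a (atype_form h) = (atp l a == h).
Proof.
move=> al; rewrite sat_conjunction; apply/forallP/eqP => [H|<- [i j]].
  by apply/ffunP => p; rewrite ffunE; apply/eqP; rewrite -sat_bits ?al.
by rewrite ffunE sat_bits ?al.
Qed.

Lemma sat_htype m a l (h : htype m l) : (forall i, i < l -> a i) ->
  satG a (htype_form h) = (htp m l a == h).
Proof.
elim: m a l h => [|m IH] a l h al; first exact: sat_atype.
case: h => h1 h2 /=; rewrite sat_atype // sat_conjunction xpair_eqE; congr (_ && _).
have E g : satG a (Ex l (htype_form g)) = (g \in [set htp m l.+1 (upd a l v) | v : G]).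
  have al' v : forall i, i < l.+1 -> upd a l v i.
    by move=> i; rewrite ltnS leq_eqVlt /upd; case: eqP => //= _; apply: al.
  transitivity [exists v, satG (upd a l v) (htype_form g)]; first by [].
  apply/existsP/imsetP => -[v]; first by rewrite (IH _ _ _ (al' v)) => /eqP<-; exists v.
  by move=> _ ->; exists v; rewrite (IH _ _ _ (al' v)).
apply/forallP/eqP => [H|<- g]; last by rewrite sat_literal E.
by apply/setP => g; apply/eqP; rewrite -E -sat_literal; apply: H.
Qed.

End Sat.
End Hintikka.

(** There are finitely many types of rank [m], and within [C] the property [P] depends on the type
    alone; [psi] is the disjunction over the types realised in [C] with [P]. *)
Lemma bf_definable N (C P : cgraph N -> Prop) m :
  (forall A B, C A -> C B -> @bf N A B m [::] [::] -> P A -> P B) ->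
  exists psi : formula 'I_N sigma_bin nat, sentence psi /\
    forall A, C A -> (P A <-> fo_models A psi).
Proof.
move=> H; pose tp (A : cgraph N) := htp m 0 (fun _ => None : option A).
have [hs hsP] : exists hs : seq (htype N m 0), forall h,
    h \in hs <-> exists A, [/\ C A, P A & tp A = h].
  suff [hs hsP] : exists hs : seq (htype N m 0), forall h, h \in hs <->
      (h \in enum (htype N m 0) /\ exists A, [/\ C A, P A & tp A = h]).
    by exists hs => h; rewrite hsP mem_enum; split=> [[]|].
  elim: (enum _) => [|h s [hs IH]].
    by exists nil => h; rewrite in_nil; split=> [|[]].
  (* Since [C] and [P] are arbitrary, excluded middle decides which types occur. *)
  case: (classic (exists A, [/\ C A, P A & tp A = h])) => [Ah|nA].
    exists (h :: hs) => g; rewrite !inE; split; last first.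
      by case=> /orP[->//|gs Ag]; apply/orP; right; apply/IH.
    by case/orP => [/eqP->|/IH[-> ?]]; rewrite ?eqxx ?orbT.
  exists hs => g; rewrite IH !inE; split; first by case=> ->; rewrite orbT.
  by case=> /orP[/eqP->//|].
exists (disjunction [seq htype_form h | h <- hs]); split.
  by rewrite /sentence; elim: hs {hsP} => //= h hs ->; rewrite cats0 sentence_htype.
move=> A CA; rewrite /fo_models /sat0 sat_disjunction has_map; split.
  move=> PA; apply/hasP; exists (tp A); first by apply/hsP; exists A.
  by rewrite /= sat_htype.
case/hasP => h /hsP[B [CB PB <-]] /=; rewrite sat_htype // => /eqP E.
apply: (H B A) => //; apply: htp_bf => //=.
have E0 (G : cgraph N) : htp m 0 (onth ([::] : seq G)) = tp G by apply: htp_ext.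
by rewrite !E0.
Qed.

(** * Construction of the orders *)

Lemma iter_le g m n : (forall n, n <= g n) -> m <= n -> iter m g 0 <= iter n g 0.
Proof.
move=> gP /subnK<-; elim: (n - m) => [|i IH] //.
by rewrite addSn iterS; apply: leq_trans IH (gP _).
Qed.

(* The counts avoid one of the #|T| + 1 disjoint open intervals between
   consecutive iterates of g. *)
Lemma gap_threshold (T : finType) (c : T -> nat) (g : nat -> nat) :
  (forall n, n <= g n) ->
  exists2 i, i <= #|T| & forall x, c x <= iter i g 0 \/ g (iter i g 0) <= c x.
Proof.
move=> gP; pose bad i x := (iter i g 0 < c x) && (c x < iter i.+1 g 0).
case: (boolP [exists i : 'I_#|T|.+1, [forall x, ~~ bad i x]]) =>
  [/existsP[i /forallP H]|].
  exists i; first by rewrite -ltnS.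
  by move=> x; have := H x; rewrite /bad iterS; lia.
rewrite negb_exists => /forallP H.
have {}H (i : 'I_#|T|.+1) : exists x, bad i x.
  by have := H i; rewrite negb_forall => /existsP[x]; rewrite negbK; exists x.
have [f fP] := fin_all_exists H.
have f_inj : injective f.
  have lt_f (i j : 'I_#|T|.+1) : i < j -> f i <> f j.
    move=> ij fij; have /andP[_ fi] := fP i; have /andP[fj _] := fP j.
    have := iter_le gP ij; rewrite -fij in fj; lia.
  move=> i j fij; case: (ltngtP i j) => [/lt_f|/lt_f/nesym|/val_inj] //.
have := leq_card f f_inj.
by rewrite card_ord ltnn.
Qed.

(** * Greedy choice of distant vertices and of slots *)

Section Greedy.
Variables (N d : nat) (G : cgraph N).
Hypothesis G_deg : forall v : G, degree v <= d.

(** Greedy choice: the vertices of [Y] and those already chosen block at most [d.+1 ^ r] candidates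
    each. *)
Lemma choose_far (I : finType) (cand : I -> {set G}) (Y : {set G}) r :
  (forall i, (#|Y| + #|I|) * d.+1 ^ r < #|cand i|) ->
  exists u : I -> G, [/\ forall i, u i \in cand i,
    forall i y, y \in Y -> u i \notin ball r y &
    forall i j, i != j -> u i \notin ball r (u j)].
Proof.
move=> big.
suff /(_ (enum I) (enum_uniq I))[u [u1 u2 u3]] : forall s : seq I, uniq s ->
    exists u : I -> G, [/\ forall i, i \in s -> u i \in cand i,
    forall i y, i \in s -> y \in Y -> u i \notin ball r y &
    forall i j, i \in s -> j \in s -> i != j -> u i \notin ball r (u j)].
  by exists u; split=> *; [apply: u1 | apply: u2 | apply: u3]; rewrite ?mem_enum.
elim=> [_|i s IH /= /andP[is_ us]].
  (* The start needs some function into [G]; if [I] is inhabited, a candidate set is nonempty and so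
     is [G]. *)
  case: (pickP I) => [i _|I0].
    have /card_gt0P[v _] : 0 < #|cand i| by apply: leq_ltn_trans (big i).
    by exists (fun _ => v).
  by exists (fun i => False_rect _ (Bool.diff_true_false (I0 i))).
have [u [u1 u2 u3]] := IH us.
pose Z := Y :|: [set u j | j in s].
have cZ : #|nbhd r Z| < #|cand i|.
  apply: leq_ltn_trans (big i); apply: leq_trans (card_nbhd _ _ G_deg) _.
  rewrite leq_mul2r; apply/orP; right; apply: leq_trans (leq_card_setU _ _) _.
  rewrite leq_add2l; apply: leq_trans (leq_imset_card _ _) _; exact: max_card.
have [v vi vZ] : exists2 v, v \in cand i & v \notin nbhd r Z.
  have /subsetPn[v ? ?] : ~~ (cand i \subset nbhd r Z); last by exists v.
  by apply/negP => /subset_leq_card; rewrite leqNgt cZ.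
have vfar z : z \in Z -> v \notin ball r z.
  by move=> zZ; apply: contra vZ => vz; apply/nbhdP; exists z.
have vs j : j \in s -> u j \in Z by move=> js; rewrite inE imset_f ?orbT.
have ne j : j \in s -> (j == i) = false.
  by move=> js; apply: contraNF is_ => /eqP<-.
exists (fun j => if j == i then v else u j); split.
- by move=> j; rewrite inE; case: (eqVneq j i) => [-> //|_ /u1].
- move=> j y; rewrite inE; case: (eqVneq j i) => [_ _ yY|_ /u2 H /H //].
  by apply: vfar; rewrite inE yY.
- move=> j j'; rewrite !inE; case: (eqVneq j i) => [->|_] /=.
    by move=> _; case: (eqVneq i j') => //= _ /vs/vfar.
  case: (eqVneq j' i) => [_|_] /= js; last exact: u3.
  by move=> _ _; rewrite ball_sym; apply/vfar/vs.
Qed.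

(** Each vertex of a ball blocks three slots, its own and the two beside it, so a window of [W]
    slots always has a free one. *)
Lemma greedy_slots (P : {set G}) (s0 base : G -> nat) W r : 3 * d.+1 ^ r < W ->
  (forall x y, x \in P -> y \in P -> x != y -> y \in ball r x -> apart (s0 x) (s0 y)) ->
  exists s : G -> nat, [/\ forall x, x \in P -> s x = s0 x,
    forall x, x \notin P -> base x <= s x < base x + W &
    forall x y, x != y -> y \in ball r x -> apart (s x) (s y)].
Proof.
move=> bigW s0P.
suff /(_ (enum G))[s [s1 s2 s3]] : forall l : seq G, exists s : G -> nat,
    [/\ forall x, x \in P -> s x = s0 x,
    forall x, x \in l -> x \notin P -> base x <= s x < base x + W &
    forall x y, (x \in P) || (x \in l) -> (y \in P) || (y \in l) -> x != y ->
       y \in ball r x -> apart (s x) (s y)].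
  exists s; split=> // [x|x y]; first by apply: s2; rewrite mem_enum.
  by apply: s3; rewrite mem_enum orbT.
elim=> [|v l [s [s1 s2 s3]]].
  by exists s0; split=> // x y; rewrite !orbF; apply: s0P.
case: (boolP ((v \in P) || (v \in l))) => [vPl|].
  have E x : (x \in P) || (x \in v :: l) -> (x \in P) || (x \in l).
    by rewrite inE orbCA => /orP[/eqP->|].
  exists s; split=> // [x xl nP|x y /E ? /E]; last exact: s3.
  by apply: s2 => //; have := E x; rewrite xl orbT (negbTE nP); apply.
rewrite negb_or => /andP[vP vl].
(* The ball also contains vertices not yet treated; their provisional slots are avoided too, which
   the bound on [W] allows for. *)
pose bad := flatten [seq [:: (s y).-1; s y; (s y).+1] | y <- enum (ball r v)].
have /hasP[n nW nbad] : has (fun n => n \notin bad) (iota (base v) W).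
  rewrite has_predC; apply/negP => /allP sub.
  have := uniq_leq_size (iota_uniq _ _) sub; rewrite size_iota leqNgt => /negP; apply.
  apply: leq_ltn_trans bigW; rewrite size_flatten /shape -map_comp.
  apply: (@leq_trans (3 * size (enum (ball r v)))); last first.
    by rewrite leq_mul2l -cardE card_ball.
  by elim: (enum _) => //= y e; rewrite mulnS leq_add2l.
have nap y : y \in ball r v -> apart n (s y).
  move=> yv; apply: contraR nbad => nap; apply/flattenP.
  exists [:: (s y).-1; s y; (s y).+1]; first by apply: map_f; rewrite mem_enum.
  by move: nap; rewrite /apart !inE; lia.
have ne x : (x \in P) || (x \in l) -> (x == v) = false.
  by apply: contraTF => /eqP->; rewrite negb_or vP.
exists (fun x => if x == v then n else s x); split.
- by move=> x xP; rewrite ne ?s1 ?xP.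
- move=> x; rewrite inE; case: eqP => [-> _ _|_ /= xl]; last exact: s2.
  by move: nW; rewrite mem_iota.
- move=> x y; rewrite !inE; case: (eqVneq x v) => [->|_] /=.
    by move=> _; case: (eqVneq y v) => //= _ _ _ /nap.
  case: (eqVneq y v) => [->|_] /=; last exact: s3.
  by move=> _ _ _; rewrite ball_sym apart_sym; apply: nap.
Qed.

End Greedy.

(** * Orders built from slots, and ordered copies of balls *)

Definition slot_lt (T : finType) (s key : T -> nat) (x y : T) : bool :=
  (s x < s y) || ((s x == s y) && (key x < key y)).

Lemma slot_lt_order (T : finType) (s key : T -> nat) :
  injective key -> strict_linear_order (slot_lt s key).
Proof.
move=> key_inj; split=> [x|y x z|x y xy]; rewrite /slot_lt; try by lia.
have : key x != key y by rewrite (inj_eq key_inj).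
by lia.
Qed.

Definition index_sorted (T : eqType) (lt : rel T) (l : seq T) : Prop :=
  forall x y, x \in l -> y \in l -> index x l < index y l -> lt x y.

Lemma index_sorted_enum (T : finType) (lt : rel T) (S : {set T}) :
  strict_linear_order lt -> exists2 l, perm_eq l (enum S) & index_sorted lt l.
Proof.
case=> irr tr tot; pose le x y := (x == y) || lt x y.
have le_tr : transitive le.
  move=> y x z; rewrite /le => /orP[/eqP->//|xy] /orP[/eqP<-|yz].
    by rewrite xy orbT.
  by rewrite (tr _ _ _ xy yz) orbT.
have le_total : total le.
  move=> x y; rewrite /le [y == x]eq_sym; case: (eqVneq x y) => //= ne; exact: tot.
exists (sort le (enum S)); first by rewrite perm_sort.
move=> x y xl yl xy.
have := sorted_ltn_index le_tr (sort_sorted le_total (enum S)) _ _ xl yl xy.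
by rewrite /le => /orP[/eqP e|//]; rewrite e ltnn in xy.
Qed.

Lemma index_sorted_lt (T : finType) (lt : rel T) (l : seq T) x y :
  strict_linear_order lt -> index_sorted lt l -> x \in l -> y \in l ->
  lt x y = (index x l < index y l).
Proof.
move=> [irr tr tot] sl xl yl; case: ltngtP => [/(sl _ _ xl yl)//|/(sl _ _ yl xl) yx|e].
  by apply/negP => xy; have := tr _ _ _ xy yx; rewrite irr.
by rewrite -(nth_index x xl) e nth_index // irr.
Qed.

Lemma zip_rel_index (X Y : eqType) (s : seq X) (t : seq Y) x y :
  uniq s -> uniq t -> zip_rel s t x y -> index x s = index y t.
Proof.
move=> us ut /zip_relP[i sx ty].
have H (Z : eqType) (r : seq Z) z : uniq r -> onth r i = Some z -> index z r = i.
  by move=> ur rz; rewrite -{1}(onth_nth z _ _ _ rz) index_uniq // -onthTE rz.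
by rewrite (H _ _ _ us sx) (H _ _ _ ut ty).
Qed.

Lemma piso_zip_uniq N (A B : cgraph N) (s : seq A) (t : seq B) :
  size s = size t -> piso (zip_rel s t) -> uniq s -> uniq t.
Proof.
elim: s t => [|x s IH] [|y t] //= [E] p /andP[xs us].
have W x1 y1 : zip_rel s t x1 y1 -> zip_rel (x :: s) (y :: t) x1 y1.
  by rewrite /zip_rel /= inE => ->; rewrite orbT.
have xy : zip_rel (x :: s) (y :: t) x y by rewrite /zip_rel /= inE eqxx.
apply/andP; split; last first.
  by apply: IH us => // x1 y1 x2 y2 /W r1 /W; apply: p r1.
apply: contra xs => yt; have [x1] := zip_rel_total (esym E) yt.
rewrite zip_rel_swap => /[dup] r1 /W r2.
by have [] := p _ _ _ _ xy r2; rewrite eqxx => /eqP-> _ _; case: (zip_rel_mem r1).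
Qed.

Lemma closed_lk N (A B : cgraph N) i (F : A -> B -> bool) x x' : piso F ->
  F x x' -> (forall y, y \in ball i x -> exists y', F y y') ->
  (forall y', y' \in ball i x' -> exists y, F y y') -> lk i F x x'.
Proof.
move=> pF; elim: i x x' => [|i IH] x x' Fx dom rng; first by rewrite lk0.
have step y y' : edge x y -> edge x' y' -> F y y' -> lk i F y y'.
  move=> xy xy' Fy; apply: IH => // z zy; [apply: dom | apply: rng].
    exact: ball_step xy zy.
  exact: ball_step xy' zy.
apply/lkSP; split=> // y xy.
  have [y' Fy] := dom _ (ball_step xy (ball_refl i y)).
  have xy' : edge x' y' by case: (pF _ _ _ _ Fx Fy) => _ <-.
  by exists y' => //; apply: step.
have [z Fz] := rng _ (ball_step xy (ball_refl i y)).
have xz : edge x z by case: (pF _ _ _ _ Fx Fz) => _ ->.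
by exists z => //; apply: step.
Qed.

Lemma lk_comp N (A B D : cgraph N) i (F : A -> B -> bool) (F' : B -> D -> bool) x y z :
  lk i F x y -> lk i F' y z -> lk i (fun x z => [exists y, F x y && F' y z]) x z.
Proof.
elim: i x y z => [|i IH] x y z.
  by rewrite !lk0 => Fx Fy; apply/existsP; exists y; rewrite Fx.
move=> /lkSP[Fx f1 b1] /lkSP[Fy f2 b2]; apply/lkSP; split.
- by apply/existsP; exists y; rewrite Fx.
- move=> x1 /f1[y1 /f2[z1 e l2] l1]; exists z1 => //; exact: IH l1 l2.
- move=> z1 /b2[y1 /b1[x1 e l2] l1]; exists x1 => //; exact: IH l2 l1.
Qed.

Lemma ordered_copy_comp N k (A B D : cgraph N) (ltA : rel A) (ltB : rel B)
    (ltD : rel D) x y z :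
  ordered_copy k ltA ltB x y -> ordered_copy k ltB ltD y z ->
  ordered_copy k ltA ltD x z.
Proof.
move=> [F [pF oF lF bF]] [F' [pF' oF' lF' bF']].
exists (fun x z => [exists y, F x y && F' y z]); split.
- move=> a a' b b' /existsP[c /andP[Fa Fa']] /existsP[e /andP[Fb Fb']].
  have [-> -> c1] := pF _ _ _ _ Fa Fb; have [-> -> c2] := pF' _ _ _ _ Fa' Fb'.
  by split=> // l; rewrite c1.
- move=> a a' b b' /existsP[c /andP[Fa Fa']] /existsP[e /andP[Fb Fb']].
  by rewrite (oF _ _ _ _ Fa Fb) (oF' _ _ _ _ Fa' Fb').
- exact: lk_comp lF lF'.
- by move=> a a' /existsP[c /andP[/bF[? _] /bF'[]]].
Qed.

Lemma lk_ordered_copy N k (A B : cgraph N) (ltA : rel A) (ltB : rel B)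
    (F : A -> B -> bool) x x' : piso F -> order_preserving ltA ltB F ->
  lk (k * k) F x x' -> ordered_copy k ltA ltB x x'.
Proof.
move=> pF oF lF.
pose F' y y' := [&& lk 0 F y y', y \in ball (k * k) x & y' \in ball (k * k) x'].
have FF y y' : F' y y' -> F y y' by case/and3P => /lk_rel.
exists F'; split.
- by move=> a a' b b' /FF ra /FF; apply: pF.
- by move=> a a' b b' /FF ra /FF; apply: oF.
- by apply: (@lk_restrict _ _ _ _ _ 0); rewrite ?ball_refl // addn0.
- by move=> y y' /and3P[].
Qed.

Section Constants.
(* M bounds the length of a list v :: l with l an enumeration of the ball of
   radius k * k; W is the number of slots among which a greedy assignment can
   always choose; the Q slots are divided into levels, counted from the ends of
   the order, of H slots each; all levels from L on are treated alike. *)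
Variables (N d k M W H L Q : nat).
Hypothesis M_large : d.+1 ^ (k * k) < M.
Hypothesis W_large : 3 * d.+1 ^ (2 * k) < W.
Hypothesis H_def : H = W + 2 * M.
Hypothesis L_def : L = 4 * k + 4.
Hypothesis Q_def : Q = 2 * (H * (L + 2)).

Local Notation R := (k * k).
Local Notation E := (4 * H).
Local Notation code := (atp M).

Definition end_dist (n : nat) : nat := minn n (Q - n).

(** The distance to the nearer end lies in the [i]-th block of [H] slots, up to a slack of [2 * M]:
    a ball laid out on every other slot around its centre spreads that far. Level [L] has no upper
    bound. *)
Definition level_slot (i n : nat) : Prop :=
  [/\ i <= L, H * i <= end_dist n + 2 * M &
      i < L -> end_dist n < H * i.+1 + 2 * M].

(* A list v :: l with l an enumeration of the ball around v, taken up to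
   isomorphism, encodes an ordered ball; Phi consists of the frequent ones and
   X of the realisations of the others and of the chosen centres. *)
Record layout (G : cgraph N) (X : {set G}) (Phi : {set atype N M})
    (lev s : G -> nat) : Prop := Layout {
  layout_code : forall v l, perm_eq l (enum (ball R v)) ->
    code (onth (v :: l)) \in Phi \/ v \in X /\ lev v = 0;
  layout_lev : forall x y, y \in ball R x -> lev y <= (lev x).+1;
  layout_near : forall v, lev v < L -> v \in nbhd (L.+1 * R) X;
  layout_slot : forall v, level_slot (lev v) (s v);
  layout_apart : forall x y, x != y -> y \in ball (2 * k) x -> apart (s x) (s y);
  layout_center : forall c j, c \in Phi -> E <= j -> j + E <= Q ->
    exists u l, [/\ u \in X, s u = j, perm_eq l (enum (ball R u)),
      code (onth (u :: l)) = c &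
      forall x y, x \in l -> y \in l -> index x l < index y l -> s x < s y]
}.

Lemma H_gt0 : 0 < H.
Proof. by move: W_large; rewrite H_def; lia. Qed.

(** * Existence of a layout *)

Section LayoutExists.
Variable G : cgraph N.
Hypothesis G_deg : forall v : G, degree v <= d.

Local Notation T := (atype N M).
(** A vertex may admit several codes, as each linear order of its ball yields one. *)
Definition admits (c : T) : {set G} :=
  [set v | has (fun l => code (onth (v :: l)) == c) (permutations (enum (ball R v)))].

Local Notation reqs := (#|T| * Q.+1).
Local Notation far := (L.+1 * R).
(** If each rare code has at most [t] realisations, the rare vertices and at most [reqs] centres
    block no more than the product; the final 1 leaves a candidate, as [choose_far] demands. *)
Definition threshold_step (t : nat) : nat := t + (t * #|T| + reqs) * d.+1 ^ far + 1.
Definition center_bound : nat := iter #|T| threshold_step 0 * #|T| + reqs.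

Section Levels.
Variables (I : finType) (Rare : {set G}) (u : I -> G) (slot : I -> nat).
Variable lst : I -> seq G.
Hypothesis u_rare : forall i y, y \in Rare -> u i \notin ball far y.
Hypothesis u_far : forall i j, i != j -> u i \notin ball far (u j).
Hypothesis slotE : forall i, E <= slot i.
Hypothesis lstP : forall i, perm_eq (lst i) (enum (ball R (u i))).

Definition center_lev i : nat := minn L (end_dist (slot i) %/ H).

(* zone n is to hold all vertices closer than about n levels to an end. *)
Definition zone (n : nat) : {set G} := nbhd (n.+1 * R) Rare :|:
  \bigcup_(i | center_lev i <= n) ball ((n - center_lev i).+1 * R) (u i).

(** The index of the first zone containing [v]; [find] returns [L] when there is none. *)
Definition lev (v : G) : nat := find (fun n => v \in zone n) (iota 0 L).

Lemma zoneP n v : reflect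
  ((exists2 y, y \in Rare & v \in ball (n.+1 * R) y) \/
   exists2 i, center_lev i <= n & v \in ball ((n - center_lev i).+1 * R) (u i))
  (v \in zone n).
Proof.
rewrite inE; apply: (iffP orP) => -[].
- by move/nbhdP; left.
- by move/bigcupP; right.
- by move/nbhdP; left.
- by move/bigcupP; right.
Qed.

Lemma zone_step n x y : x \in zone n -> y \in ball R x -> y \in zone n.+1.
Proof.
move=> /zoneP[[z zR xz]|[i ni xi]] yx; apply/zoneP;
  [left; exists z | right; exists i] => //.
- by rewrite mulSn addnC; apply: ball_trans xz yx.
- exact: leqW.
- by rewrite subSn // mulSn addnC; apply: ball_trans xi yx.
Qed.

Lemma lev_le v : lev v <= L.
Proof. by rewrite /lev -[X in _ <= X](size_iota 0) find_size. Qed.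

Lemma lev_zone v : lev v < L -> v \in zone (lev v).
Proof.
move=> lv; have hv : has (fun n => v \in zone n) (iota 0 L) by rewrite has_find size_iota.
by have := nth_find 0 hv; rewrite nth_iota // add0n.
Qed.

Lemma zone_lev n v : v \in zone n -> lev v <= n.
Proof.
move=> vn; rewrite leqNgt; apply/negP => nl.
have nL : n < L := leq_trans nl (lev_le v).
by have := before_find 0 nl; rewrite nth_iota // add0n vn.
Qed.

Lemma lev_step x y : y \in ball R x -> lev y <= (lev x).+1.
Proof.
move=> yx; case: (ltnP (lev x) L) => [/lev_zone xl|xL].
  by apply: zone_lev; apply: zone_step xl yx.
by apply: leq_trans (lev_le y) _; apply: leqW.
Qed.

Lemma lev_near v : lev v < L -> v \in nbhd far (Rare :|: [set u i | i in I]).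
Proof.
move=> /[dup] lv /lev_zone/zoneP[[y yR vy]|[i _ vi]]; apply/nbhdP.
  exists y; first by rewrite inE yR.
  by apply: ball_le vy; rewrite leq_mul2r ltnS ltnW ?orbT.
exists (u i); first by rewrite inE imset_f ?orbT.
apply: ball_le vi; rewrite leq_mul2r ltnS; apply/orP; right.
by apply: leq_trans (leq_subr _ _) (ltnW lv).
Qed.

Lemma lev_rare v : v \in Rare -> lev v = 0.
Proof.
move=> vR; apply/eqP; rewrite -leqn0; apply: zone_lev; apply/zoneP; left.
by exists v; rewrite ?ball_refl.
Qed.

Lemma far_trans (m n : nat) (x y z : G) : z \in ball m x -> z \in ball n y ->
  m + n <= far -> y \in ball far x.
Proof.
by move=> zx zy mn; apply: ball_le mn _; apply: ball_trans zx _; rewrite ball_sym.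
Qed.

(** A zone of smaller index reaching [v] from elsewhere would put [u i] within [far] of a rare
    vertex or of another centre, which the choice of centres excludes. *)
Lemma lev_center i v : v \in ball R (u i) -> lev v = center_lev i.
Proof.
move=> vi; apply/eqP; rewrite eqn_leq; apply/andP; split.
  apply: zone_lev; apply/zoneP; right; exists i => //.
  by rewrite subnn mul1n.
case: (ltnP (lev v) L) => [/[dup] lv /lev_zone/zoneP|]; last first.
  by apply: leq_trans; apply: geq_minl.
case=> [[y yR vy]|[j jl vj]].
  have := u_rare i yR; rewrite (far_trans vy vi) //.
  by rewrite -mulSnr leq_mul2r ltnS lv orbT.
case: (eqVneq i j) => [->//|/u_far].
rewrite (far_trans vj vi) //.
by rewrite -mulSnr leq_mul2r ltnS (leq_ltn_trans (leq_subr _ _) lv) orbT.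
Qed.

(* The balls around the centres use every other slot, in the order prescribed
   by lst. *)
Definition s0 (v : G) : nat :=
  if [pick i | v \in ball R (u i)] is Some i
  then slot i + 2 * index v (lst i) - 2 * index (u i) (lst i) else 0.

Lemma R2_far : 2 * k <= 2 * R /\ 4 * R <= far.
Proof.
split; first by rewrite leq_mul2l /=; case: (posnP k) => [->//|]; exact: leq_pmulr.
by rewrite leq_mul2r L_def; apply/orP; right; lia.
Qed.

Lemma center_inj i j (x y : G) : x \in ball R (u i) -> y \in ball R (u j) ->
  y \in ball (2 * k) x -> i = j.
Proof.
move=> xi yj yx; case: (eqVneq i j) => // /u_far.
have [k2 R4] := R2_far.
have xj : x \in ball (R + 2 * k) (u j) by apply: ball_trans yj _; rewrite ball_sym.
by rewrite (far_trans xj xi) //; move: k2 R4; lia.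
Qed.

Lemma s0_center i v : v \in ball R (u i) ->
  s0 v = slot i + 2 * index v (lst i) - 2 * index (u i) (lst i).
Proof.
move=> vi; rewrite /s0; case: pickP => [j vj|/(_ i)]; last by rewrite vi.
by rewrite (center_inj vi vj (ball_refl _ _)).
Qed.

Lemma index_lst i v : v \in ball R (u i) -> index v (lst i) < M.
Proof.
move=> vi; have : index v (lst i) < size (lst i).
  by rewrite index_mem (perm_mem (lstP i)) mem_enum.
rewrite (perm_size (lstP i)) -cardE => /leq_trans; apply.
by apply: leq_trans (card_ball _ _ G_deg) _; apply: ltnW.
Qed.

(** Indices are below [M] and [slot i] is at least [E], which exceeds [2 * M]; so the truncated
    subtraction in [s0] is exact. *)
Lemma slot_bounds i v : v \in ball R (u i) ->
  [/\ 2 * index (u i) (lst i) <= slot i,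
      slot i <= s0 v + 2 * M & s0 v <= slot i + 2 * M].
Proof.
move=> vi; have := index_lst vi; have := index_lst (ball_refl R (u i)).
by rewrite (s0_center vi); have := slotE i; rewrite H_def => *; split; lia.
Qed.

Lemma s0_level i v : v \in ball R (u i) -> level_slot (lev v) (s0 v).
Proof.
move=> vi; have [_ b1 b2] := slot_bounds vi.
split; first exact: lev_le.
  rewrite (lev_center vi) /center_lev.
  apply: (@leq_trans (end_dist (slot i))).
    by rewrite mulnC; apply: leq_trans (leq_divM _ H); rewrite leq_mul2r geq_minr orbT.
  by rewrite /end_dist; lia.
rewrite (lev_center vi) => cl.
have : end_dist (slot i) < H * (center_lev i).+1.
  move: cl; rewrite /center_lev gtn_min ltnn /= => cl.
  by rewrite (minn_idPr (ltnW cl)) mulnC ltn_ceil // H_gt0.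
by rewrite /end_dist; lia.
Qed.

(** [Q] is twice [H * (L + 2)], so such an [n] lies in the left half and is its own distance to the
    nearer end. *)
Lemma top_level_slot i n : i <= L -> H * i <= n -> n < H * i + W -> level_slot i n.
Proof.
move=> iL lo hi; have HiL : H * i <= H * L by rewrite leq_mul2l iL orbT.
by split=> // [|_]; rewrite /end_dist Q_def; move: lo hi; rewrite H_def; lia.
Qed.

Lemma s0_apart x y : x \in \bigcup_i ball R (u i) -> y \in \bigcup_i ball R (u i) ->
  x != y -> y \in ball (2 * k) x -> apart (s0 x) (s0 y).
Proof.
move=> /bigcupP[i _ xi] /bigcupP[j _ yj] xy yx.
have ij := center_inj xi yj yx; rewrite -ij in yj.
have [b _ _] := slot_bounds xi; rewrite (s0_center xi) (s0_center yj) /apart.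
have xl : x \in lst i by rewrite (perm_mem (lstP i)) mem_enum.
have ne : index x (lst i) != index y (lst i).
  by apply: contraNneq xy => e; rewrite -(nth_index x xl) e nth_index //
    (perm_mem (lstP i)) mem_enum.
by move: ne; lia.
Qed.

End Levels.

(** A code has at most [t] realisations, and is rare, or at least [g t], enough for [choose_far] to
    give each request a centre far from rare vertices and other centres. [greedy_slots] extends the
    slots of their balls to [G]. As [n] is at most [#|T|], [center_bound] does not depend on [G]. *)
Lemma layout_exists : exists (X : {set G}) Phi lev s,
  layout X Phi lev s /\ #|X| <= center_bound.
Proof.
pose g := threshold_step.
have g_le n : n <= g n by rewrite /g /threshold_step -addnA leq_addr.
have [n nT nP] := gap_threshold (fun c => #|admits c|) g_le.
set t := iter n g 0 in nP.
pose Phi := [set c | g t <= #|admits c|].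
pose Rare := \bigcup_(c in ~: Phi) admits c.
have card_Rare : #|Rare| <= t * #|T|.
  apply: leq_trans (card_bigU _ _) _.
  apply: (@leq_trans (\sum_(c in ~: Phi) t)).
    by apply: leq_sum => c; rewrite !inE => /negbTE cP; case: (nP c) => //; rewrite cP.
  by rewrite sum_nat_const mulnC leq_mul2l max_card orbT.
(* One request for each frequent code and each slot outside the margins. *)
pose good_req (p : T * 'I_Q.+1) := [&& p.1 \in Phi, E <= p.2 & p.2 + E <= Q].
pose I : finType := {p | good_req p}.
have card_I : #|I| <= reqs.
  by rewrite card_sig; apply: leq_trans (max_card _) _; rewrite card_prod card_ord.
have [|u [u1 u2 u3]] := choose_far G_deg 
    (cand := fun i : I => admits (val i).1) (Y := Rare) (r := far).
  move=> i; have : (val i).1 \in Phi by case/and3P: (valP i).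
  rewrite inE; apply: leq_trans; rewrite /g /threshold_step -addnA addn1.
  apply: leq_trans (leq_addl _ _); rewrite ltnS leq_mul2r; apply/orP; right.
  exact: leq_add.
have lstex (i : I) : exists l : seq G, perm_eq l (enum (ball R (u i))) /\
    code (onth (u i :: l)) = (val i).1.
  have := u1 i; rewrite inE => /hasP[l]; rewrite mem_permutations => pl /eqP cl.
  by exists l.
have [lst lstP] := fin_all_exists lstex.
pose slot (i : I) : nat := (val i).2.
have slotE i : E <= slot i by case/and3P: (valP i).
have slotQ i : slot i + E <= Q by case/and3P: (valP i).
have pl i := proj1 (lstP i).
pose lv := lev Rare u slot.
pose P := \bigcup_i ball R (u i).
have [s [s1 s2 s3]] := greedy_slots G_deg (fun v => H * lv v) W_large
  (s0_apart u3 slotE pl).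
exists (Rare :|: [set u i | i in I]), Phi, lv, s; split; last first.
  apply: leq_trans (leq_card_setU _ _) _; apply: leq_add.
    apply: leq_trans card_Rare _; rewrite leq_mul2r; apply/orP; right.
    exact: iter_le.
  exact: leq_trans (leq_imset_card _ _) card_I.
split.
- move=> v l plv; case: (boolP (code (onth (v :: l)) \in Phi)) => [|cP]; first by left.
  have vR : v \in Rare.
    apply/bigcupP; exists (code (onth (v :: l))); rewrite ?inE //.
      by rewrite inE in cP.
    by apply/hasP; exists l; rewrite ?mem_permutations.
  by right; rewrite inE vR /lv lev_rare.
- exact: lev_step.
- exact: lev_near.
- move=> v; case: (boolP (v \in P)) => [vP|/[dup] vP /s2 /andP[lo hi]].
    by rewrite (s1 _ vP); case/bigcupP: vP => i _; apply: s0_level.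
  exact: top_level_slot (lev_le _ _ _ _) lo hi.
- exact: s3.
- move=> c j cP Ej jE.
  have jQ : j < Q.+1 by lia.
  have req : good_req (c, Ordinal jQ) by rewrite /good_req /= cP Ej.
  pose i : I := Sub (c, Ordinal jQ) req.
  have uP v : v \in ball R (u i) ->
      s v = slot i + 2 * index v (lst i) - 2 * index (u i) (lst i).
    move=> vi; rewrite s1; last by apply/bigcupP; exists i.
    exact: (s0_center slot lst u3 vi).
  exists (u i), (lst i); split.
  + by rewrite inE imset_f ?orbT.
  + by rewrite uP ?ball_refl // addnK.
  + exact: pl.
  + by case: (lstP i).
  + move=> x y; rewrite !(perm_mem (pl i)) !mem_enum => xi yi xy.
    have [b _ _] := slot_bounds u3 slotE pl xi; rewrite !uP //.
    by move: xy b; lia.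
Qed.

End LayoutExists.

(** The margin of [4 * H] per round covers the two slacks of [2 * M], each below [H], the width of a
    level and the change of level by one. *)
Lemma level_deep n i j a b : n < k -> level_slot i a -> level_slot j b ->
  i <= j.+1 -> n.+1 * E <= a -> a + n.+1 * E <= Q -> deep Q E n b.
Proof.
move=> nk [iL i1 i2] [jL j1 j2] ij a1 a2; have H0 := H_gt0.
have i_ge : 4 * n + 3 <= i.
  rewrite leqNgt; apply/negP => lt_i.
  have iL' : i < L by rewrite L_def; lia.
  have : H * i.+1 <= H * (4 * n + 3) by rewrite leq_mul2l lt_i orbT.
  by move: (i2 iL') a1 a2; rewrite /end_dist; move: H_def; lia.
have : H * (4 * n + 2) <= H * j by rewrite leq_mul2l; apply/orP; right; lia.
by move: j1; rewrite /deep /end_dist; move: H_def; lia.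
Qed.

(** [L = 4 * k + 4] exceeds [k] margins of four levels by enough to absorb the slack, so level [L]
    is deep. *)
Lemma shallow_level i a : level_slot i a -> ~~ deep Q E k a -> i < L.
Proof.
move=> [iL i1 _] nd; rewrite ltn_neqAle iL andbT; apply: contra nd => /eqP iL'.
have H0 := H_gt0; move: i1; rewrite iL' L_def /deep /end_dist.
by move: H_def; lia.
Qed.

(** Rare vertices have level 0; hence [universal], which concerns deep vertices, only needs the
    frequent codes. *)
Lemma bottom_level a : level_slot 0 a -> ~~ deep Q E 1 a.
Proof.
move=> [_ _ hi]; have: end_dist a < H * 1 + 2 * M by apply: hi; rewrite L_def; lia.
by rewrite /deep /end_dist; have := H_gt0; move: H_def; lia.
Qed.

Lemma Q_bound : 2 * (k * E) <= Q.
Proof. by rewrite Q_def L_def; lia. Qed.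

Lemma code_size (G : cgraph N) (v : G) l : (forall v : G, degree v <= d) ->
  perm_eq l (enum (ball R v)) -> size (v :: l) <= M.
Proof.
move=> deg /perm_size sl; rewrite /= sl -cardE.
by apply: leq_ltn_trans M_large; apply: card_ball.
Qed.

(** Equal codes match the two enumerations position by position, which preserves the order; the
    centre at the head of the list ensures that [z] is matched with [u]. *)
Lemma code_ordered_copy (A B : cgraph N) (ltA : rel A) (ltB : rel B)
    (z : A) (u : B) l l' :
  (forall v : A, degree v <= d) -> (forall v : B, degree v <= d) ->
  strict_linear_order ltA -> strict_linear_order ltB ->
  perm_eq l (enum (ball R z)) -> perm_eq l' (enum (ball R u)) ->
  code (onth (z :: l)) = code (onth (u :: l')) ->
  index_sorted ltA l -> index_sorted ltB l' -> ordered_copy k ltA ltB z u.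
Proof.
move=> degA degB oA oB pl pl' cE sl sl'.
have szE : size l = size l'.
  by have := atp_size (code_size degA pl) (code_size degB pl') cE => -[].
have p := atp_piso (code_size degA pl) cE.
have lP x : (x \in l) = (x \in ball R z) by rewrite (perm_mem pl) mem_enum.
have lP' x : (x \in l') = (x \in ball R u) by rewrite (perm_mem pl') mem_enum.
have ul : uniq l by rewrite (perm_uniq pl) enum_uniq.
have ul' : uniq l' by rewrite (perm_uniq pl') enum_uniq.
have sub x x' : zip_rel l l' x x' -> zip_rel (z :: l) (u :: l') x x'.
  by rewrite /zip_rel /= inE => ->; rewrite orbT.
have zu : zip_rel (z :: l) (u :: l') z u by rewrite /zip_rel /= inE eqxx.
have pF : piso (zip_rel l l') by move=> x x' y y' /sub rx /sub; apply: p rx.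
exists (zip_rel l l'); split=> //.
- move=> x x' y y' rx ry; have [[xl xl'] [yl yl']] := (zip_rel_mem rx, zip_rel_mem ry).
  rewrite (index_sorted_lt oA sl xl yl) (index_sorted_lt oB sl' xl' yl').
  by rewrite (zip_rel_index ul ul' rx) (zip_rel_index ul ul' ry).
- apply: closed_lk => //.
  + have [u' zu'] := zip_rel_total szE (etrans (lP z) (ball_refl _ _)).
    have [e _ _] := p _ _ _ _ zu (sub _ _ zu').
    by move: e zu'; rewrite eqxx => /esym/eqP->.
  + by move=> y; rewrite -lP; apply: zip_rel_total.
  + move=> y; rewrite -lP' => /(zip_rel_total (esym szE))[x].
    by rewrite zip_rel_swap; exists x.
- by move=> x x' /zip_rel_mem; rewrite lP lP'.
Qed.

(** * Copying a layout to the second graph *)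

Section Transport.
Variables (A B : cgraph N).
Hypothesis A_deg : forall v : A, degree v <= d.
Hypothesis B_deg : forall v : B, degree v <= d.
Variables (X : {set A}) (Phi : {set atype N M}) (lev sA : A -> nat).
Hypothesis lay : layout X Phi lev sA.

(** The core contains the [R]-balls around all vertices of level below [L]; the larger copied part
    leaves room for [lk] of depth [R + 2 * k] at every core vertex. *)
Definition core_radius : nat := L.+1 * R + R.
Definition copy_radius : nat := core_radius + R + 2 * k.
Local Notation core := (nbhd core_radius X).
Local Notation l := (enum (nbhd copy_radius X)).

Variable l' : seq B.
Hypothesis ll' : bf M.+2 l l'.

Local Notation F := (zip_rel l l').

Let pF : piso F := bf_piso ll'.
Let szl : size l = size l' := bf_size ll'.

Lemma copy_inj x x' y : F x y -> F x' y -> x = x'.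
Proof. by move=> r r'; have [] := pF r r'; rewrite eqxx => /eqP. Qed.

Lemma copy_total x : x \in nbhd copy_radius X -> exists y, F x y.
Proof. by move=> xX; apply: zip_rel_total szl _; rewrite mem_enum. Qed.

Lemma core_copy x : x \in core -> exists y, F x y.
Proof. by move=> xc; apply: copy_total; apply: nbhd_le xc; rewrite /copy_radius; lia. Qed.

Lemma copy_lk i x y : x \in core -> i <= R + 2 * k -> F x y -> lk i F x y.
Proof.
move=> xc ik r; apply: bf_lk ll' r _ => z zx; rewrite mem_enum.
by apply: nbhd_le (nbhd_trans xc zx); rewrite /copy_radius; lia.
Qed.

Lemma near_core x : x \in nbhd (L.+1 * R) X -> {subset ball R x <= core}.
Proof. by move=> xX y yx; apply: nbhd_trans xX yx. Qed.

Lemma near_subcore x : x \in nbhd (L.+1 * R) X -> x \in core.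
Proof. by move=> xX; apply: (near_core xX); apply: ball_refl. Qed.

(** The default [L] is consistent because the [R]-ball of every vertex of level below [L] is copied:
    a vertex without preimage is never adjacent in level to the ends. *)
Definition levB (y : B) : nat := if [pick x | F x y] is Some x then lev x else L.

Lemma levB_copy x y : F x y -> levB y = lev x.
Proof.
move=> r; rewrite /levB; case: pickP => [x' r'|/(_ x)]; last by rewrite r.
by rewrite (copy_inj r r').
Qed.

Lemma levB_low y : levB y < L -> exists x, [/\ F x y, lev x = levB y &
  x \in nbhd (L.+1 * R) X].
Proof.
rewrite {1}/levB; case: pickP => [x r xL|_]; last by rewrite ltnn.
by exists x; rewrite (levB_copy r); split=> //; apply: (layout_near lay).
Qed.

Lemma levB_le y : levB y <= L.
Proof.
by rewrite /levB; case: pickP => // x _; case: (layout_slot lay x).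
Qed.

Lemma levB_step x y : y \in ball R x -> levB y <= (levB x).+1.
Proof.
move=> yx; case: (ltnP (levB x) L) => [/levB_low[a [r <- aX]]|xL]; last first.
  by apply: leq_trans (levB_le y) _; apply: leqW.
have la : lk (R + 0) F a x.
  by apply: copy_lk r; rewrite ?near_subcore // addn0 leq_addr.
have [b ba /lk_rel rb] := lk_ball_back la yx.
by rewrite (levB_copy rb); apply: (layout_lev lay).
Qed.

Definition coreB : {set B} := [set y | [exists x in core, F x y]].

Lemma coreBP y : reflect (exists2 x, x \in core & F x y) (y \in coreB).
Proof. by rewrite inE; apply: exists_inP. Qed.

Definition core_slot (y : B) : nat := if [pick x | F x y] is Some x then sA x else 0.

Lemma core_slot_copy x y : F x y -> core_slot y = sA x.
Proof.
move=> r; rewrite /core_slot; case: pickP => [x' r'|/(_ x)]; last by rewrite r.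
by rewrite (copy_inj r r').
Qed.

Lemma core_slot_apart y z : y \in coreB -> z \in coreB -> y != z ->
  z \in ball (2 * k) y -> apart (core_slot y) (core_slot z).
Proof.
move=> /coreBP[a ac ra] /coreBP[b bc rb] yz zy.
have la : lk (2 * k + 0) F a y by apply: copy_lk ra; rewrite // addn0 leq_addl.
have [b' b'a /lk_rel rb'] := lk_ball_back la zy.
rewrite -(copy_inj rb rb') in b'a.
rewrite (core_slot_copy ra) (core_slot_copy rb); apply: (layout_apart lay) b'a.
by case: (pF ra rb) => ->.
Qed.

Section Orders.
Variable sB : B -> nat.
Hypothesis sB_core : forall y, y \in coreB -> sB y = core_slot y.
Hypothesis sB_rest : forall y, y \notin coreB -> H * L <= sB y < H * L + W.
Hypothesis sB_apart : forall x y, x != y -> y \in ball (2 * k) x -> apart (sB x) (sB y).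

Lemma sB_copy x y : x \in core -> F x y -> sB y = sA x.
Proof.
by move=> xc r; rewrite sB_core ?(core_slot_copy r) //; apply/coreBP; exists x.
Qed.

Lemma levB_slot y : level_slot (levB y) (sB y).
Proof.
case: (boolP (y \in coreB)) => [/coreBP[x xc r]|ny].
  by rewrite (levB_copy r) (sB_copy xc r); apply: (layout_slot lay).
suff -> : levB y = L by have /andP[] := sB_rest ny; apply: top_level_slot.
apply/eqP; rewrite eqn_leq levB_le leqNgt; apply: contra ny => /levB_low[x [r _ xX]].
by apply/coreBP; exists x => //; apply: near_subcore.
Qed.

(* Ties are broken along l and l', so that the copied part carries the same order. *)
Definition key (T : finType) (r : seq T) (x : T) : nat :=
  if x \in r then index x r else size r + enum_rank x.

Lemma key_inj (T : finType) (r : seq T) : injective (key r).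
Proof.
move=> x y; rewrite /key; case: ifP => xr; case: ifP => yr.
- by move=> e; rewrite -(nth_index x xr) e nth_index.
- by rewrite -index_mem in xr => e; rewrite e ltnNge leq_addr in xr.
- by rewrite -index_mem in yr => e; rewrite -e ltnNge leq_addr in yr.
- by move/addnI/ord_inj/enum_rank_inj.
Qed.

Definition ltA : rel A := slot_lt sA (key l).
Definition ltB : rel B := slot_lt sB (key l').

Lemma ul' : uniq l'.
Proof. by apply: piso_zip_uniq szl pF _; apply: enum_uniq. Qed.

Lemma orderA : strict_linear_order ltA.
Proof. exact: slot_lt_order (@key_inj _ _). Qed.

Lemma orderB : strict_linear_order ltB.
Proof. exact: slot_lt_order (@key_inj _ _). Qed.

Lemma slottedA : slotted k Q E sA ltA.
Proof.
split.
- exact: orderA.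
- by move=> x y xy; rewrite /ltA /slot_lt xy.
- exact: (layout_apart lay).
- move=> n v y nk yv; apply: level_deep nk (layout_slot lay v) (layout_slot lay y) _.
  by apply: (layout_lev lay); rewrite ball_sym.
Qed.

Lemma slottedB : slotted k Q E sB ltB.
Proof.
split.
- exact: orderB.
- by move=> x y xy; rewrite /ltB /slot_lt xy.
- exact: sB_apart.
- move=> n v y nk yv; apply: level_deep nk (levB_slot v) (levB_slot y) _.
  by apply: levB_step; rewrite ball_sym.
Qed.

Definition Io (x : A) (y : B) : bool := (x \in core) && F x y.

Lemma Io_piso : piso Io.
Proof. by move=> x x' y y' /andP[_ rx] /andP[_ ry]; apply: pF. Qed.

Lemma Io_order : order_preserving ltA ltB Io.
Proof.
move=> x x' y y' /andP[xc rx] /andP[yc ry].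
have keyE a b : F a b -> key l a = key l' b.
  move=> r; have [al bl] := zip_rel_mem r; rewrite /key al bl.
  by apply: zip_rel_index r; [apply: enum_uniq | apply: ul'].
by rewrite /ltA /ltB /slot_lt (sB_copy xc rx) (sB_copy yc ry) (keyE _ _ rx) (keyE _ _ ry).
Qed.

Lemma Io_lk x y : x \in nbhd (L.+1 * R) X -> F x y -> lk R Io x y.
Proof.
move=> xX r.
have : lk (R + 0) F x y by apply: copy_lk r; rewrite ?near_subcore // addn0 leq_addr.
move/(lk_restrict (leqnn _) (ball_refl 0 x) (ball_refl 0 y)); apply: lk_mono => z z'.
by case/and3P => /lk_rel rz zx _; rewrite /Io rz (near_core xX).
Qed.

Lemma endsAB : common_ends k Q E ltA ltB sA sB Io.
Proof.
split; [exact: Io_piso | exact: Io_order | |].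
  by move=> x x' /andP[xc r]; rewrite (sB_copy xc r).
move=> x /(shallow_level (layout_slot lay x))/(layout_near lay) xX.
have [y r] := core_copy (near_subcore xX).
by exists y; apply: Io_lk.
Qed.

Lemma endsBA : common_ends k Q E ltB ltA sB sA (swap_rel Io).
Proof.
split.
- exact: piso_swap Io_piso.
- exact: order_preserving_swap Io_order.
- by move=> x x' /andP[xc r]; rewrite (sB_copy xc r).
- move=> y /(shallow_level (levB_slot y))/levB_low[x [r _ xX]].
  by exists x; rewrite lk_swap; apply: Io_lk.
Qed.

Lemma slots_index_sorted s' r : (forall x y, x \in r -> y \in r ->
  index x r < index y r -> sA x < sA y) -> index_sorted (slot_lt sA s') r.
Proof. by move=> H' x y xr yr /(H' _ _ xr yr); rewrite /slot_lt => ->. Qed.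

Lemma center_near u : u \in X -> u \in nbhd (L.+1 * R) X.
Proof. by move=> uX; apply/nbhdP; exists u; rewrite ?ball_refl. Qed.

(** A deep [z] is not at level 0, so its sorted ball has a frequent code; the centre for this code
    and slot [j] is then carried to [B] by [Io]. *)
Lemma univAB : universal k Q E ltA ltB sA sB.
Proof.
move=> z j dz Ej jQ.
have [lz plz slz] := index_sorted_enum (ball R z) orderA.
case: (layout_code lay plz) => [cP|[_ lz0]]; last first.
  by have := layout_slot lay z; rewrite lz0 => /bottom_level; rewrite dz.
have [u [lu [uX su plu clu slu]]] := layout_center lay cP Ej jQ.
have uX' := center_near uX.
have [u' r] := core_copy (near_subcore uX').
exists u'; first by rewrite (sB_copy (near_subcore uX') r).
apply: (@ordered_copy_comp _ _ _ _ _ _ ltA _ _ u).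
  apply: code_ordered_copy plz plu _ slz _ => //; try exact: orderA.
  exact: slots_index_sorted.
exact: lk_ordered_copy Io_piso Io_order (Io_lk uX' r).
Qed.

(** The remaining back moves pull the sorted ball of [z] back to [A], where its code turns out to be
    frequent; the centre for it lies in [A] already. *)
Lemma univBA : universal k Q E ltB ltA sB sA.
Proof.
move=> z j dz Ej jQ.
have [lz plz slz] := index_sorted_enum (ball R z) orderB.
(* At most [M] rounds pull [z :: lz] back; one more is kept for [bf_lk]. *)
have szz : size (z :: lz) + 1 <= M.+2.
  by have := code_size B_deg plz; rewrite /= addn1; lia.
have [[|a la] // [szE] bfa] := bf_back (bf_le szz ll').
have p2 := bf_piso bfa; set F2 := zip_rel _ _ in p2.
have F2l x y : F2 x y = F x y || zip_rel (a :: la) (z :: lz) x y.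
  exact: zip_rel_cat szl.
have lzP x : (x \in lz) = (x \in ball R z) by rewrite (perm_mem plz) mem_enum.
have F2a x y : zip_rel la lz x y -> F2 x y.
  by rewrite F2l /zip_rel /= inE => ->; rewrite !orbT.
have az : F2 a z by rewrite F2l /zip_rel /= inE eqxx orbT.
have laz : lk (R + 0) F2 a z.
  rewrite addn0 -lk_swap.
  apply: (@lk_mono _ _ _ _ (zip_rel (l' ++ z :: lz) (l ++ a :: la))).
    by move=> x y; rewrite zip_rel_swap.
  apply: (bf_lk (bf_swap bfa)); first by rewrite zip_rel_swap.
  by move=> x; rewrite -lzP mem_cat inE orbA => ->; rewrite orbT.
have F2_inj x x' y : F2 x y -> F2 x' y -> x = x'.
  by move=> r r'; have [] := p2 _ _ _ _ r r'; rewrite eqxx => /eqP.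
(* [lk] in both directions shows that the pulled-back list exhausts the ball of [a], so that
   [layout_code] applies to it. *)
have pla : perm_eq la (enum (ball R a)).
  apply: uniq_perm; [|exact: enum_uniq|].
    apply: (piso_zip_uniq (esym szE)); last by rewrite (perm_uniq plz) enum_uniq.
    by apply: piso_zip_swap => x x' y y' /F2a r /F2a; apply: p2.
  move=> y; rewrite mem_enum; apply/idP/idP.
    move=> /(zip_rel_total szE)[y' r]; have [_] := zip_rel_mem r.
    rewrite lzP => /(lk_ball_back laz)[w wa /lk_rel rw].
    by rewrite (F2_inj _ _ _ (F2a _ _ r) rw).
  move=> /(lk_ball laz)[y' ]; rewrite -lzP => /(zip_rel_total (esym szE))[w].
  rewrite zip_rel_swap => rw /lk_rel ry.
  by rewrite (F2_inj _ _ _ ry (F2a _ _ rw)); case: (zip_rel_mem rw).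
have cE : code (onth (z :: lz)) = code (onth (a :: la)).
  apply: piso_atp; first by rewrite /= szE.
  apply: piso_zip_swap => x x' y y' rx ry; apply: p2; rewrite F2l ?rx ?ry orbT //.
(* If [a] is in [X] at level 0, then [z] is its copy and lies near an end as well, contrary to
   [dz]. *)
case: (layout_code lay pla) => [|[aX a0]]; last first.
  have ac := near_subcore (center_near aX).
  have [z' r] := core_copy ac.
  have r2 : F2 a z' by rewrite F2l r.
  have [/esym] := p2 _ _ _ _ az r2; rewrite eqxx => /eqP zz' _ _.
  have := layout_slot lay a; rewrite a0 -(sB_copy ac r) -zz' => /bottom_level.
  by rewrite dz.
rewrite -cE => cP.
have [u [lu [uX su plu clu slu]]] := layout_center lay cP Ej jQ.
exists u => //.
apply: code_ordered_copy plz plu _ slz _ => //; [exact: orderB | exact: orderA|].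
exact: slots_index_sorted.
Qed.

End Orders.

Lemma transport : exists (lt : rel A) (lt' : rel B),
  [/\ strict_linear_order lt, strict_linear_order lt' &
      moves lt lt' k (fun _ _ => false)].
Proof.
(* Vertices of [B] outside the copied core all go to the window of level [L]. *)
have [sB [sB1 sB2 sB3]] := greedy_slots B_deg (fun _ => H * L) W_large core_slot_apart.
exists ltA, (ltB sB); split; [exact: orderA | exact: orderB |].
apply: (layout_moves Q_bound) (endsAB sB1) (endsBA sB1 sB2)
  (univAB sB1) (univBA sB1) => //.
  exact: slottedA.
exact: slottedB.
Qed.

End Transport.

Definition game_rank : nat :=
  center_bound * d.+1 ^ copy_radius + M.+2.

Lemma bf_orders (A B : cgraph N) :
  (forall v : A, degree v <= d) -> (forall v : B, degree v <= d) ->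
  @bf N A B game_rank [::] [::] -> exists (lt : rel A) (lt' : rel B),
  [/\ strict_linear_order lt, strict_linear_order lt' &
      moves lt lt' k (fun _ _ => false)].
Proof.
move=> degA degB bAB; have [X [Phi [lv [s [lay cX]]]]] := layout_exists degA.
have sz : size (enum (nbhd copy_radius X)) + M.+2 <= game_rank.
  rewrite -cardE leq_add2r; apply: leq_trans (card_nbhd _ _ degA) _.
  by rewrite leq_mul2r cX orbT.
have [l' _ bl'] := bf_forth (bf_le sz bAB).
exact: (transport degA degB lay bl').
Qed.
End Constants.

(** * From first-order equivalence to the inclusion in FO *)

Lemma bf_game N d k : exists m, forall A B : cgraph N,
  (forall v : A, degree v <= d) -> (forall v : B, degree v <= d) ->
  @bf N A B m [::] [::] -> exists (lt : rel A) (lt' : rel B),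
  [/\ strict_linear_order lt, strict_linear_order lt' &
      moves lt lt' k (fun _ _ => false)].
Proof.
(* The rank must not depend on the graphs; unification sets it to [game_rank], with [M] and [W] one
   above their lower bounds. *)
eexists => A B degA degB.
by apply: (bf_orders (k := k) (ltnSn _) (ltnSn _) erefl erefl erefl degA degB).
Qed.

Theorem mainTheorem1
  (Sigma : choiceType) (Sigma_inf : infinite_alphabet Sigma)
  (N d : nat)
  (C : cgraph N -> Prop)
  (C_deg : forall A : cgraph N, C A -> forall v : A, degree v <= d)
  (phi : cformula N Sigma) (phi_cfo : cfo_sentence phi)
  (phi_inv : order_invariant phi) :
  exists psi : formula 'I_N sigma_bin nat,
    sentence psi /\
    (forall A : cgraph N, C A -> (inv_models A phi <-> fo_models A psi)).
Proof.
have [k phi_k] := phi_cfo; have [m game] := bf_game N d k.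
apply: (@bf_definable N C (fun A => inv_models A phi) m).
move=> A B CA CB bAB [lt0 order0 lt0_phi].
have [lt [lt' [order order' mv]]] := game _ _ (C_deg _ CA) (C_deg _ CB) bAB.
(* Order-invariance on [A] passes from the given order to [lt], and the game from [lt] on [A] to
   [lt'] on [B]. *)
exists lt' => //; rewrite -(moves_ord_models phi_k mv).
exact: (proj1 (phi_inv _ _ _ order0 order)).
Qed.
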